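(* Let $G$ be a finite group, $\ell$ a prime with $\ell\mid|G|$, $Q$ a Sylow $\ell$-subgroup of $G$ and $M\lneq G$ a proper subgroup. Let $\mathcal H\le\mathcal G$ be a subgroup, and let $\mathfrak G\subseteq\mathrm{Irr}(G)$ and $\mathfrak M\subseteq\mathrm{Irr}(M)$. Assume all of the following: (i) There exist a group $\check G$ with $G\lhd\check G$ and a finite group $E$ such that $\check G\rtimes E$ is defined, $\check G/G$ is abelian, $\mathrm C_{\check G\rtimes E}(G)=\mathrm Z(\check G)\mathrm C_E(G)$, $G\lhd\check G\rtimes E$, and $\mathfrak G$ and $\mathfrak M$ are $\mathcal H\times\mathrm N_{\check G}(M)$-stable. (ii) $M$ is $(\check G\rtimes E)_Q$-stable and $\mathrm N_G(Q)\le M\lneq G$. (iii) Maximal extendibility holds with respect to $G\lhd\check G$ and $M\lhd\check M:=\mathrm N_{\check G}(M)$ for $\mathfrak G$ and $\mathfrak M$, respectively. (iv) For $\hat M:=\mathrm N_{GE}(M)$ there exist $\hat M$-stable $\check M$-transversals $\mathfrak G_0$ in $\mathfrak G$ and $\mathfrak M_0$ in $\mathfrak M$. Additionally there exist $\hat M$-equivariant extension maps $\Phi_{glo}$ and $\Phi_{loc}$ with respect to $G\lhd GE$ for $\mathfrak G_0$ and with respect to $M\lhd\hat M$ for $\mathfrak M_0$, such that $\mathrm{Irr}(\mathrm C_E(G)\mid\Phi_{glo}(\chi))=\mathrm{Irr}(\mathrm C_E(G)\mid\Phi_{loc}(\psi))$ for every $\chi\in\mathfrak G_0$ and $\psi\in\mathfrak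 M_0$. (v) There exists a subgroup $B\le\check GE\times\mathcal H$ with $\mathrm N_{\check GE}(Q)B=\mathrm N_{\check GE}(Q)\times\mathcal H$ that stabilizes $\mathfrak G_0$ and $\mathfrak M_0$. (vi) For $\check{\mathfrak M}:=\mathrm{Irr}(\check M\mid\mathfrak M)$ and $\check{\mathfrak G}:=\mathrm{Irr}(\check G\mid\mathfrak G)$ there exists an $\mathrm{Irr}(\check M/M)\rtimes(\hat MB)$-equivariant bijection $\check\Omega:\check{\mathfrak G}\to\check{\mathfrak M}$ with $\check\Omega(\check{\mathfrak G}\cap\mathrm{Irr}(\check G\mid\nu))=\check{\mathfrak M}\cap\mathrm{Irr}(\check M\mid\nu)$ for every $\nu\in\mathrm{Irr}(\mathrm Z(\check G))$. Then there exists an $\hat M\check M\times\mathcal H$-equivariant bijection $\Omega:\mathfrak G\to\mathfrak M$ such that $$((\check GE)_\chi,G,\chi)\ge_c((\check M\hat M)_\psi,M,\psi)\quad\text{for every }\chi\in\mathfrak G\text{ and }\psi:=\Omega(\chi).$$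
   Context: $\mathbb Q^{\mathrm{ab}}$ is the field generated over $\mathbb Q$ by all roots of unity in $\mathbb C$ and $\mathcal G:=\mathrm{Gal}(\mathbb Q^{\mathrm{ab}}/\mathbb Q)$, acting on the set $\mathrm{Irr}(X)$ of irreducible complex characters of a finite group $X$ via values. If $G\lhd A$, then $\mathcal G\times A$ acts on $\mathrm{Irr}(G)$. For $X\le Y$, $\mathrm{Irr}(Y\mid\mathfrak X)$ (for $\mathfrak X\subseteq\mathrm{Irr}(X)$, or a single character of $X$) is the set of irreducible characters of $Y$ having a constituent in $\mathfrak X$ on restriction to $X$, and $\mathrm{Irr}(X\mid\theta)$ (for a character $\theta$ of $Y$) is the set of irreducible constituents of the restriction of $\theta$ to $X$. Subscripts denote stabilizers. A $Y$-transversal is a set containing exactly one element of each $Y$-orbit. Linear characters of $\check M/M$ act by multiplication on $\mathrm{Irr}(\check M)$, and on $\mathrm{Irr}(\check G)$ via $\check M/M\cong\check G/G$. For $G\lhd A$ and $\mathfrak X\subseteq\mathrm{Irr}(G)$, an extension map with respect to $G\lhd A$ for $\mathfrak X$ is a map $\Lambda:\mathfrak X\to\bigcup_{G\le I\le A}\mathrm{Irr}(I)$ such that $\Lambda(\chi)$ is an extension of $\chi$ to $A_\chi$ for all $\chi\in\mathfrak X$; maximal extendibility holds with respect to $G\lhd A$ for $\mathfrak X$ if such a map exists. Let $G\lhd A$, $\chi\in\mathrm{Irr}(G)$ be $A$-invariant, $H\le A$ with $A=GH$, $\mathrm C_A(G)\le H$, $M:=G\cap H$, and $\psi\in\mathrm{Irr}(M)$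 be $H$-invariant. Write $(A,G,\chi)\ge_c(H,M,\psi)$ if there exist projective representations $\mathcal P$ of $A$ associated to $\chi$ and $\mathcal P'$ of $H$ associated to $\psi$ such that the factor set of $\mathcal P$ restricted to $H\times H$ is the factor set of $\mathcal P'$, and for every $c\in\mathrm C_A(G)$ the matrices $\mathcal P(c)$ and $\mathcal P'(c)$ are scalar matrices with the same scalar. *)

(* Defs.v *)
From HB Require Import structures.
From mathcomp Require Import all_boot all_order all_fingroup all_algebra.
From mathcomp Require Import all_solvable all_field all_character.
From mathcomp Require Import boolp.

Set Implicit Arguments.
Unset Strict Implicit.
Unset Printing Implicit Defensive.

Import Order.TTheory GRing.Theory Num.Theory.
Local Open Scope group_scope.
Local Open Scope ring_scope.

(* algC plays the role of the complex numbers, as throughout mathcomp's       *)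
(* character theory. Q^ab is the intersection of all the subfields of algC    *)
(* that contain every root of unity.                                          *)
Definition Qab_pred : {pred algC} := fun x =>
  `[< forall S : {pred algC}, divring_closed S ->
      (forall (n : nat) (z : algC), (0 < n)%N -> n.-unity_root z -> z \in S) ->
      x \in S >].

Lemma Qab_divring_closed : divring_closed Qab_pred.
Proof.
split.
- by apply/asboolP => S [].
- move=> x y /asboolP Sx /asboolP Sy; apply/asboolP => S cS uS.
  by have [_ + _] := cS; apply; [apply: Sx | apply: Sy].
- move=> x y /asboolP Sx /asboolP Sy; apply/asboolP => S cS uS.
  by have [_ _] := cS; apply; [apply: Sx | apply: Sy].
Qed.

HB.instance Definition _ :=
  GRing.isDivringClosed.Build algC Qab_pred Qab_divring_closed.

Record Qab : Type := MkQab { Qab_val : algC; _ : Qab_val \in Qab_pred }.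

HB.instance Definition _ := [isSub for Qab_val].
HB.instance Definition _ := [Choice of Qab by <:].
HB.instance Definition _ := [SubChoice_isSubComUnitRing of Qab by <:].
HB.instance Definition _ := [SubComUnitRing_isSubIntegralDomain of Qab by <:].
HB.instance Definition _ := [SubIntegralDomain_isSubField of Qab by <:].

(* Ring automorphisms of Q^ab automatically fix the prime field Q pointwise.  *)
Definition Qab_automorphism (f : Qab -> Qab) : Prop :=
  [/\ zmod_morphism f, GRing.monoid_morphism f & bijective f].

(* The group Gal(Q^ab / Q); products compose from left to right, so that it   *)
(* acts on the right (it is abelian, but this is not needed here).            *)
Record galQab : Type :=
  MkGalQab { gal_fun :> Qab -> Qab; _ : `[< Qab_automorphism gal_fun >] }.

HB.instance Definition _ := [isSub for gal_fun].
HB.instance Definition _ := [Choice of galQab by <:].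

Lemma galP (s : galQab) : Qab_automorphism s.
Proof. by case: s => f /= /asboolP. Qed.

Lemma gal_zmod_morphism (s : galQab) : zmod_morphism s.
Proof. by case: (galP s). Qed.

Lemma gal_monoid_morphism (s : galQab) : GRing.monoid_morphism s.
Proof. by case: (galP s). Qed.

HB.instance Definition _ (s : galQab) :=
  GRing.isZmodMorphism.Build Qab Qab s (gal_zmod_morphism s).
HB.instance Definition _ (s : galQab) :=
  GRing.isMonoidMorphism.Build Qab Qab s (gal_monoid_morphism s).

Lemma gal_bij (s : galQab) : bijective s.
Proof. by case: (galP s). Qed.

Lemma gal_invP (s : galQab) : exists g, cancel s g /\ cancel g s.
Proof. by have [g sK gK] := gal_bij s; exists g. Qed.

Lemma gal_one_subproof : `[< Qab_automorphism (@idfun Qab) >].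
Proof. by apply/asboolP; split => //; exists idfun. Qed.

Lemma gal_mul_subproof (s t : galQab) : `[< Qab_automorphism (t \o s) >].
Proof.
apply/asboolP; split; last exact: bij_comp (gal_bij t) (gal_bij s).
- exact: rmorphB (t \o s).
- by split=> [|x y] /=; rewrite ?rmorph1 ?rmorphM.
Qed.

Lemma gal_inv_subproof (s : galQab) :
  `[< Qab_automorphism (sval (cid (gal_invP s))) >].
Proof.
case: cid => g /= [sK gK]; have [sB [s1 sM] _] := galP s.
apply/asboolP; split; last by exists s.
- by move=> x y; rewrite -{1}[x]gK -{1}[y]gK -sB sK.
- by split=> [|x y]; [rewrite -s1 sK | rewrite -{1}[x]gK -{1}[y]gK -sM sK].
Qed.

Definition gal_one : galQab := MkGalQab gal_one_subproof.
Definition gal_mul (s t : galQab) : galQab := MkGalQab (gal_mul_subproof s t).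
Definition gal_inv (s : galQab) : galQab := MkGalQab (gal_inv_subproof s).

Lemma gal_mulA : associative gal_mul.
Proof. by move=> s t u; apply: val_inj. Qed.

Lemma gal_mul1 : left_id gal_one gal_mul.
Proof. by move=> s; apply: val_inj. Qed.

Lemma gal_mulr1 : right_id gal_one gal_mul.
Proof. by move=> s; apply: val_inj. Qed.

Lemma gal_mulV : left_inverse gal_one gal_inv gal_mul.
Proof.
by move=> s; apply: val_inj; apply/funext => x /=; case: cid => g [] /=.
Qed.

Lemma gal_mulrV : right_inverse gal_one gal_inv gal_mul.
Proof.
by move=> s; apply: val_inj; apply/funext => x /=; case: cid => g [] /=.
Qed.

HB.instance Definition _ :=
  isGroup.Build galQab gal_mulA gal_mul1 gal_mulr1 gal_mulV gal_mulrV.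

(* The value outside Q^ab is junk: character values lie in Q^ab (irr_Qab      *)
(* below), and gal_IirrE shows that applying s to the values of an            *)
(* irreducible character yields an irreducible character.                     *)
Definition gal_app (s : galQab) (a : algC) : algC :=
  val (s (insubd (0 : Qab) a)).

Lemma gal_app_val (s : galQab) (a : Qab) : gal_app s (val a) = val (s a).
Proof. by rewrite /gal_app valKd. Qed.

Lemma gal_app0 (s : galQab) : gal_app s 0 = 0.
Proof. by rewrite (gal_app_val s 0) rmorph0. Qed.

Lemma unity_root_Qab n z : (0 < n)%N -> z ^+ n = 1 -> z \in Qab_pred.
Proof.
move=> n0 zn; apply/asboolP => S _ uS.
by apply: (uS n) => //; apply/unity_rootP.
Qed.

Lemma gal_app_sum (s : galQab) (I : finType) (f : I -> algC) :
  (forall i, f i \in Qab_pred) ->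
  gal_app s (\sum_i f i) = \sum_i gal_app s (f i).
Proof.
move=> Qf; pose g i : Qab := MkQab (Qf i).
have ->: \sum_i f i = val (\sum_i g i) by rewrite raddf_sum.
rewrite gal_app_val !raddf_sum.
by apply: eq_bigr => i _; rewrite -[f i]/(val (g i)) gal_app_val.
Qed.

Lemma gal_app_unity_root (s : galQab) n : (0 < n)%N ->
  exists u : {rmorphism algC -> algC},
    forall z, z ^+ n = 1 -> gal_app s z = u z.
Proof.
move=> n0; have [w pw] := C_prim_root_exists n0.
pose wQ : Qab := MkQab (unity_root_Qab n0 (prim_expr_order pw)).
have pwQ : n.-primitive_root wQ by rewrite -(fmorph_primitive_root val).
have pv : n.-primitive_root (val (s wQ)) by rewrite !fmorph_primitive_root.
have [[k /= ltkn] Dk] := prim_rootP pw (prim_expr_order pv).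
have cok : coprime k n by rewrite -(prim_root_exp_coprime k pw) -Dk.
have [u Du] := Qn_aut_exists cok; exists u => z zn.
have [[m /= _] ->] := prim_rootP pw zn.
rewrite rmorphXn /= Du ?(prim_expr_order pw) // -Dk.
by rewrite -[w ^+ m]/(val wQ ^+ m) -rmorphXn gal_app_val !rmorphXn.
Qed.

Section CharacterActions.

Variables (gT : finGroupType) (X : {group gT}).

Lemma irr_unity_sum (i : Iirr X) x : x \in X ->
  exists n (e : 'rV[algC]_n),
    (forall j, e 0 j ^+ #|X| = 1) /\ 'chi_i x = \sum_j e 0 j.
Proof.
move=> Xx; have /char_reprP[rX ->] := irr_char i.
have [e [_ [e1 _] [-> _] _]] := repr_rsim_diag rX Xx.
exists (rdegree rX), e; split=> // j.
by have /dvdnP[q ->] := order_dvdG Xx; rewrite mulnC exprM e1 expr1n.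
Qed.

Lemma irr_Qab (i : Iirr X) x : 'chi_i x \in Qab_pred.
Proof.
have [Xx | notXx] := boolP (x \in X); last by rewrite cfun0 // rpred0.
have [n [e [e1 ->]]] := irr_unity_sum i Xx.
by rewrite rpred_sum // => j _; apply: unity_root_Qab (e1 j).
Qed.

Definition cfGal (s : galQab) : 'CF(X) -> 'CF(X) := cfun_comp (gal_app0 s).

Definition gal_Iirr (s : galQab) (i : Iirr X) : Iirr X :=
  cfIirr (cfGal s 'chi_i).

Lemma gal_IirrE s i : 'chi_(gal_Iirr s i) = cfGal s 'chi_i.
Proof.
rewrite cfIirrE //; have [u Du] := gal_app_unity_root s (cardG_gt0 X).
suff ->: cfGal s 'chi_i = cfAut u 'chi_i by rewrite cfAut_irr mem_irr.
apply/cfun_inP => x Xx; rewrite !cfunE.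
have [n [e [e1 ->]]] := irr_unity_sum i Xx.
rewrite gal_app_sum ?rmorph_sum => [|j]; last exact: unity_root_Qab (e1 j).
by apply: eq_bigr => j _; rewrite Du.
Qed.

(* The action of (a, s) in N(X) x Gal(Q^ab/Q) on Irr(X), both factors acting  *)
(* on the right. (For a \notin 'N(X), conjg_Iirr i a is just i.)              *)
Definition act_Iirr (i : Iirr X) (p : gT * galQab) : Iirr X :=
  gal_Iirr p.2 (conjg_Iirr i p.1).

End CharacterActions.

Section Actions.

Variable gT : finGroupType.

Definition pred_prod (A : {set gT}) (H : {pred galQab}) :
    {pred gT * galQab} :=
  [pred p | (p.1 \in A) && (p.2 \in H)].

(* The product set (A x 1) B.                                                 *)
Definition lprod (A : {set gT}) (B : {pred gT * galQab}) :
    gT * galQab -> Prop :=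
  fun p => exists a b, [/\ a \in A, b \in B & p = ((a, 1%g) * b)%g].

Definition act_stable (X : {group gT}) (D : {pred gT * galQab})
    (S : {set Iirr X}) : Prop :=
  {in D, forall p, {in S, forall i, act_Iirr i p \in S}}.

Definition conjg_stable (X : {group gT}) (A : {set gT})
    (S : {set Iirr X}) : Prop :=
  {in A, forall a, {in S, forall i, conjg_Iirr i a \in S}}.

(* T is a Y-transversal in the Y-stable set S.                                *)
Definition conjg_transversal (X : {group gT}) (Y : {set gT})
    (T S : {set Iirr X}) : Prop :=
  T \subset S /\ {in S, forall i, #|T :&: cfclass_Iirr Y i| = 1%N}.

Definition Irr_over (Y X : {group gT}) (S : {set Iirr X}) : {set Iirr Y} :=
  [set i | [exists j in S, j \in irr_constt ('Res[X] 'chi[Y]_i)]].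

Definition Irr_under (X Y : {group gT}) (theta : 'CF(Y)) : {set Iirr X} :=
  [set j | j \in irr_constt ('Res[X] theta)].

Definition bij_on (I J : finType) (S : {set I}) (T : {set J}) (f : I -> J) :
    Prop :=
  {in S &, injective f} /\ f @: S = T.

(* An extension map is a family L, with L i an irreducible character of the   *)
(* stabilizer of 'chi_i; the values of L outside S are irrelevant.            *)
Definition extension_map (A G : {group gT}) (S : {set Iirr G})
    (L : forall i : Iirr G, Iirr 'I_A['chi_i]) : Prop :=
  {in S, forall i, 'Res[G] 'chi_(L i) = 'chi_i}.

Definition maximal_extendibility (A G : {group gT}) (S : {set Iirr G}) :
    Prop :=
  exists L : forall i : Iirr G, Iirr 'I_A['chi_i], extension_map S L.

(* 'chi_(L (i ^ y)) = 'chi_(L i) ^ y, as functions on gT: the two sides are   *)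
(* class functions of the conjugate groups 'I_A['chi_i ^ y] and               *)
(* 'I_A['chi_i] :^ y, and cfConjg only covers y normalising 'I_A['chi_i].     *)
Definition equivariant_extension_map (Y : {set gT}) (A G : {group gT})
    (S : {set Iirr G}) (L : forall i : Iirr G, Iirr 'I_A['chi_i]) : Prop :=
  extension_map S L /\
  {in Y, forall y, {in S, forall i, forall x,
     'chi_(L (conjg_Iirr i y)) (x ^ y)%g = 'chi_(L i) x}}.

(* mu in Irr(Y / G) is the image of la in Irr(Mc / M) under the isomorphism   *)
(* of character groups induced by Mc / M -> Y / G, x M |-> x G.               *)
Definition matching_chars (Y G Mc M : {group gT})
    (mu : Iirr (Y / G)) (la : Iirr (Mc / M)) : Prop :=
  {in Mc, forall x, 'chi_mu (coset G x) = 'chi_la (coset M x)}.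

End Actions.

Section CharacterTriples.

Variable gT : finGroupType.

Definition projective_repr (A : {group gT}) (n : nat)
    (P : gT -> 'M[algC]_n) (alpha : gT -> gT -> algC) : Prop :=
  {in A, forall x, P x \in unitmx} /\
  {in A &, forall x y, alpha x y != 0 /\
                       P x *m P y = alpha x y *: P (x * y)%g}.

(* Associated to chi, in the usual sense for character triples: P restricts   *)
(* to an ordinary representation of G affording chi and is multiplicative     *)
(* against elements of G on either side.                                      *)
Definition associated_to (A G : {group gT}) (chi : 'CF(G)) (n : nat)
    (P : gT -> 'M[algC]_n) : Prop :=
  [/\ exists2 rG : mx_representation algC G n,
        {in G, P =1 rG} & cfRepr rG = chi,
      {in G & A, forall g a, P (g * a)%g = P g *m P a} &
      {in G & A, forall g a, P (a * g)%g = P a *m P g}].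

(* (A, G, chi_i) >=_c (H, M, chi_j)                                           *)
Definition ge_c (A G : {group gT}) (i : Iirr G)
    (H M : {group gT}) (j : Iirr M) : Prop :=
  [/\ G <| A /\ A \subset 'I['chi_i],
      [/\ H \subset A, (G * H)%g = A & 'C_A(G) \subset H],
      G :&: H = M /\ H \subset 'I['chi_j] &
      exists n (P : gT -> 'M[algC]_n) alpha n' (P' : gT -> 'M[algC]_n') alpha',
        [/\ projective_repr A P alpha /\ associated_to A 'chi_i P,
            projective_repr H P' alpha' /\ associated_to H 'chi_j P',
            {in H &, forall x y, alpha x y = alpha' x y} &
            {in 'C_A(G), forall c, exists z : algC,
               P c = z%:M /\ P' c = z%:M}]].

End CharacterTriples.

(* Main.v *)
Require Import Defs.
From mathcomp Require Import all_boot all_order all_fingroup all_algebra.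
From mathcomp Require Import all_solvable all_field all_character.

Set Implicit Arguments.
Unset Strict Implicit.
Unset Printing Implicit Defensive.

Import Order.TTheory GRing.Theory Num.Theory.
Local Open Scope group_scope.
Local Open Scope ring_scope.

(** Write H for the product Mc Mh.

    Group theory. As Q is a Sylow subgroup of G and N_G(Q) is contained in M,
    Frattini's argument gives N_G(M) = M and L = G N_L(M) for every L between G
    and A = Gc E. Hence H = N_A(M) supplements G in A, and Mc / M is canonically
    Gc / G, so that linear characters mu of Gc / G and la of Mc / M match.

    The bijection. Because Gc / G is abelian, its linear characters permute
    transitively the irreducible characters of Gc over a given chi
    ([abelian_quotient_transitive]). The bijection Omegac on the characters of
    Gc and Mc respects twisting, so it induces a bijection between the
    Mc-orbits in GG and in MM, that is, between the transversals GG0 and MM0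
    ([related]). To transport it along the orbits one needs that chi in GG0 and
    its partner psi in MM0 have the same stabilizer in Mc. Let k lie over chi,
    where chi extends to its inertia group T in Gc. Then k is induced from an
    extension t of chi, and a twist of k by mu equals k exactly if mu is trivial
    on T: an induced character vanishes outside the normal subgroup T, and
    conversely t is determined by k and does not vanish on any coset of G in T.
    So the inertia group is read off from the twists that fix k, and Omegac
    preserves these ([related_Inertia_Mc]). The bijection obtained is
    equivariant under Mc and under Mh B, hence under H x HH because N_A(Q) B is
    all of N_A(Q) x HH and N_A(Q) is contained in H.

    The character triples. By conjugation one may take chi in GG0. Uniqueness in
    the transversal gives A_chi = X Y with X the inertia group in Gc and Y the
    one in GE. Choose representations rX affording t and rY affording
    Phi_glo chi that agree on G; then P (x y) = rX x rY y is a projective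
    representation associated to chi. Its factor set records by which scalar
    rY y intertwines rX with its y-conjugate. By Schur's lemma this scalar is a
    linear character of X / G, and it is the restriction of a mu such that k is
    the mu-twist of its y-conjugate ([correspondent_twist],
    [intertwining_twist]). The same construction for psi produces the matching
    la, because Omegac is equivariant; so the factor sets agree on H. Finally
    C_A(G) = Z(Gc) C_E(G) acts by scalars, and these agree globally and locally:
    Omegac preserves the character of Z(Gc) below, and Phi_glo chi and
    Phi_loc psi have the same constituents on C_E(G). *)

(** * Conjugation of irreducible characters *)

Section ConjugateIrr.

Variables (gT : finGroupType) (N : {group gT}).
Implicit Type i : Iirr N.

Lemma conjg_IirrM i : {in 'N(N) &, forall y z,
  conjg_Iirr i (y * z) = conjg_Iirr (conjg_Iirr i y) z}.
Proof.
by move=> y z nNy nNz; apply: irr_inj; rewrite !conjg_IirrE cfConjgMnorm.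
Qed.

Lemma conjg_Iirr_fixed i y :
  y \in 'N(N) -> (y \in 'I['chi_i]) = (conjg_Iirr i y == i).
Proof.
move=> nNy; rewrite inE nNy -conjg_IirrE /=.
by apply/eqP/eqP=> [/irr_inj | ->].
Qed.

Lemma conjg_Iirr_inertia i y : y \in 'I['chi_i] -> conjg_Iirr i y = i.
Proof. by move=> Iy; apply: irr_inj; rewrite conjg_IirrE inertiaJ. Qed.

Lemma conjg_Iirr_inner i y : y \in N -> conjg_Iirr i y = i.
Proof. by move=> Ny; rewrite conjg_Iirr_inertia ?(subsetP (sub_inertia _)). Qed.

Lemma conjg_Iirr_eq i : {in 'N(N) &, forall y z,
  (conjg_Iirr i y == conjg_Iirr i z) = (y * z^-1 \in 'I['chi_i])%g}.
Proof.
move=> y z nNy nNz; rewrite conjg_Iirr_fixed ?groupM ?groupV //.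
rewrite conjg_IirrM ?groupV //.
apply/eqP/eqP=> [-> | iE]; first exact: conjg_IirrK.
by rewrite -[in RHS]iE conjg_IirrKV.
Qed.

Lemma irr_constt_Res_conjg (X : {group gT}) i (k : Iirr X) y :
    y \in 'N(X) -> y \in 'N(N) ->
  (conjg_Iirr i y \in irr_constt ('Res[N] 'chi_(conjg_Iirr k y))) =
  (i \in irr_constt ('Res[N] 'chi_k)).
Proof.
move=> nXy nNy; rewrite !irr_consttE !conjg_IirrE -cfConjgRes_norm //.
by rewrite cfConjg_iso.
Qed.

Lemma irr_constt_Res_cfclass (X : {group gT}) (k : Iirr X) i i' :
    N <| X -> i \in irr_constt ('Res[N] 'chi_k) ->
    i' \in irr_constt ('Res[N] 'chi_k) ->
  exists2 y, y \in X & i' = conjg_Iirr i y.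
Proof.
move=> nsNX ki; rewrite irr_consttE (Clifford_Res_sum_cfclass nsNX ki).
rewrite cfdotZl mulf_eq0 negb_or reindex_cfclass // => /andP[_].
have [|no_y] := boolP (i' \in cfclass_Iirr X i).
  by case/imsetP=> y Xy -> _; exists y.
rewrite cfdot_suml big1 ?eqxx // => m im; rewrite cfdot_irr.
case: eqP => // Dm; case/negP: no_y.
by rewrite cfclass_IirrE -Dm.
Qed.

Lemma mem_Irr_over (X : {group gT}) (S : {set Iirr N}) i (k : Iirr X) :
  i \in S -> i \in irr_constt ('Res[N] 'chi_k) -> k \in Irr_over X S.
Proof. by move=> Si ki; rewrite inE; apply/exists_inP; exists i. Qed.

End ConjugateIrr.

(** * Twisting by linear characters of an abelian quotient *)

Section AbelianQuotient.

Variables (gT : finGroupType) (X N : {group gT}).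
Hypotheses (nsNX : N <| X) (abXN : abelian (X / N)).
Implicit Types (i : Iirr N) (k : Iirr X) (mu : Iirr (X / N)).

Lemma abelian_mod_lin_char mu : ('chi_mu %% N)%CF \is a linear_char.
Proof. exact/cfMod_lin_char/char_abelianP. Qed.

Lemma mul_mod_IirrE k mu :
  'chi_(mul_mod_Iirr k mu) = ('chi_mu %% N)%CF * 'chi_k.
Proof.
by rewrite cfIirrE mod_IirrE // ?mul_lin_irr ?mem_irr ?abelian_mod_lin_char.
Qed.

(** Inducing the restriction of k1 to N amounts to multiplying k1 by the regular
    character of X / N, whose constituents are all the linear characters mu; so
    the constituents of the induced character are the twists of k1, and k2 is
    one of them as soon as both lie over a common i. *)
Lemma abelian_quotient_transitive i k1 k2 :
    i \in irr_constt ('Res[N] 'chi_k1) -> i \in irr_constt ('Res[N] 'chi_k2) ->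
  exists mu, k2 = mul_mod_Iirr k1 mu.
Proof.
move=> k1i k2i.
have nz: '['Ind[X] ('Res[N] 'chi_k1), 'chi_k2] != 0.
  rewrite -cfdot_Res_r.
  apply/eqP=> /(constt_ortho_char (cfRes_char _ (irr_char _))
    (cfRes_char _ (irr_char _)) k1i k2i)/eqP.
  by rewrite cfnorm_irr oner_eq0.
have res0: 'Res[N, X] 'chi_0 = 'chi_0 by rewrite !irr0 rmorph1.
have [_ _ _ def1] := constt_Ind_ext nsNX res0.
rewrite -['Res _]mul1r cfIndM ?normal_sub // -irr0 def1 mulr_suml in nz.
have [mu Dmu | no_mu] := pickP (fun mu => k2 == mul_mod_Iirr k1 mu).
  by exists mu; apply/eqP.
case/eqP: nz; rewrite cfdot_suml big1 // => mu _.
rewrite -scalerAl cfdotZl mul_mod_IirrE irr0 mulr1 -mul_mod_IirrE.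
by rewrite cfdot_irr eq_sym no_mu mulr0.
Qed.

Lemma irr_constt_mul_mod i k mu :
  (i \in irr_constt ('Res[N] 'chi_(mul_mod_Iirr k mu))) =
  (i \in irr_constt ('Res[N] 'chi_k)).
Proof.
rewrite mul_mod_IirrE rmorphM /= cfRes_sub_ker ?cfker_mod //.
by rewrite cfMod1 lin_char1 ?scale1r ?mul1r //; apply/char_abelianP.
Qed.

End AbelianQuotient.

(** * The Clifford correspondent of an extendible character *)

Section ExtendibleClifford.

Variables (gT : finGroupType) (X N : {group gT}) (i : Iirr N).
Hypotheses (nsNX : N <| X) (abXN : abelian (X / N)).
Let T := 'I_X['chi_i]%G.

Let nsNT : N <| T. Proof. exact/normal_Inertia/normal_sub. Qed.
Let sTX : T \subset X. Proof. exact: subsetIl. Qed.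

(** The correspondent of k lies over i, as does the extension c; they differ by
    a linear character of T / N, so the correspondent is an extension too. *)
Lemma extension_correspondent (c : Iirr T) k :
    'Res[N] 'chi_c = 'chi_i -> i \in irr_constt ('Res[N] 'chi_k) ->
  exists t : Iirr T, 'Res[N] 'chi_t = 'chi_i /\ 'Ind[X] 'chi_t = 'chi_k.
Proof.
move=> cE ki; have [indA _ indAB _ _] := constt_Inertia_bijection i nsNX.
have: k \in irr_constt ('Ind[X] 'chi_i) by rewrite constt_Ind_Res.
rewrite -indAB => /imsetP[s As ->]; exists s; rewrite cfIirrE ?indA //.
split=> //; have abT: abelian (T / N) by apply: abelianS (quotientS N sTX) abXN.
have [|| mu ->] := @abelian_quotient_transitive _ T N nsNT abT i c s.
- by rewrite cE constt_irr inE.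
- by rewrite -constt_Ind_Res.
rewrite mul_mod_IirrE // rmorphM /= cfRes_sub_ker ?cfker_mod // cfMod1.
by rewrite cE lin_char1 ?scale1r ?mul1r //; apply/char_abelianP.
Qed.

Lemma norm_Inertia_irr y : y \in 'N(X) -> y \in 'I['chi_i] -> y \in 'N(T).
Proof.
move=> nXy Iy; have nNy := subsetP (norm_inertia _) _ Iy.
rewrite inE -[gval T]/(X :&: 'I['chi_i])%g conjIg (normP nXy) conjg_inertia //.
by rewrite (inertiaJ Iy).
Qed.

(** Both t and the mu-twist of its y-conjugate lie over i and induce k, so they
    coincide by the Clifford correspondence. *)
Lemma correspondent_twist (t : Iirr T) k (mu : Iirr (X / N)) y :
    'Res[N] 'chi_t = 'chi_i -> 'Ind[X] 'chi_t = 'chi_k ->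
    y \in 'N(X) -> y \in 'I['chi_i] ->
    k = mul_mod_Iirr (conjg_Iirr k y) mu ->
  {in T, forall x, 'chi_t x = 'chi_mu (coset N x) * 'chi_t (x ^ y^-1)%g}.
Proof.
move=> tE tk nXy Iy kE; have nTy := norm_Inertia_irr nXy Iy.
have nNy := subsetP (norm_inertia _) _ Iy.
have [_ injA _ _ _] := constt_Inertia_bijection i nsNX.
pose la := 'Res[T] ('chi_mu %% N)%CF.
have linla: la \is a linear_char.
  exact/cfRes_lin_char/abelian_mod_lin_char.
have /irrP[s sE]: la * ('chi_t ^ y)%CF \in irr T.
  by rewrite mul_lin_irr // cfConjg_irr // mem_irr.
have resla: 'Res[N] la = 1.
  rewrite /la cfResRes // ?(normal_sub nsNT) // cfRes_sub_ker ?cfker_mod //.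
  by rewrite lin_char1 ?scale1r // abelian_mod_lin_char.
have resS: 'Res[N] 'chi_s = 'chi_i.
  rewrite -sE rmorphM /= resla mul1r -cfConjgRes_norm //.
  by rewrite tE inertiaJ.
have indS: 'Ind[X] 'chi_s = 'chi_k.
  rewrite -sE mulrC cfIndM // -cfConjgInd_norm // tk {2}kE.
  by rewrite mul_mod_IirrE // mulrC conjg_IirrE.
have inA (u : Iirr T) :
    'Res[N] 'chi_u = 'chi_i -> u \in irr_constt ('Ind[T] 'chi_i).
  by move=> uE; rewrite constt_Ind_Res uE constt_irr inE.
have Dst: s = t by apply: injA; rewrite ?inA // /Ind_Iirr indS tk.
move=> x Tx; rewrite -{1}Dst -sE cfunE cfResE // cfModE ?(subsetP sTX) //.
by rewrite cfConjgE.
Qed.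

End ExtendibleClifford.

Lemma irr_repr_abs_irr (gT : finGroupType) (X : {group gT}) n
    (rX : mx_representation algC X n) :
  cfRepr rX \in irr X -> mx_absolutely_irreducible rX.
Proof.
case/irr_reprP=> rG irrG /cfRepr_inj simX.
by apply: groupC; apply: mx_rsim_irr (mx_rsim_sym simX) irrG.
Qed.

(** The matrices of N span the full matrix algebra, so if t vanished on x N then
    the trace form would annihilate the invertible matrix of x. *)
Lemma extension_nonvanishing (gT : finGroupType) (X N : {group gT})
    (t : Iirr X) (i : Iirr N) x :
    N \subset X -> 'Res[N] 'chi_t = 'chi_i -> x \in X ->
  exists2 g, g \in N & 'chi_t (x * g)%g != 0.
Proof.
move=> sNX tE Xx; have /char_reprP[[n rX] /= tX] := irr_char t.
have /mx_abs_irrP[n_gt0 [a_ aE]]: mx_absolutely_irreducible (subg_repr rX sNX).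
  by apply: irr_repr_abs_irr; rewrite cfRepr_sub -tX tE mem_irr.
have [g /andP[Ng nz] | no_g] :=
    pickP (fun g => (g \in N) && ('chi_t (x * g)%g != 0)); first by exists g.
have tr0 B : \tr (rX x *m B) = 0.
  rewrite [B]aE mulmx_sumr raddf_sum big1 // => g Ng.
  have Xg := subsetP sNX g Ng.
  rewrite -scalemxAr [LHS]mxtraceZ -repr_mxM //.
  have := no_g g; rewrite Ng tX cfunE groupM // => /negbFE/eqP.
  by rewrite mulrb => ->; rewrite mulr0.
have := tr0 (rX x^-1%g); rewrite -repr_mxM ?groupV // mulgV repr_mx1 mxtrace1.
by move/eqP; rewrite pnatr_eq0 eqn0Ngt n_gt0.
Qed.

(** * Inertia groups detected by twists *)

Section Stabilizer.

Variables (gT : finGroupType) (X N : {group gT}) (i : Iirr N).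
Hypotheses (nsNX : N <| X) (abXN : abelian (X / N)).
Let T := 'I_X['chi_i]%G.

Let sTX : T \subset X. Proof. exact: subsetIl. Qed.
Let nsNT : N <| T. Proof. exact/normal_Inertia/normal_sub. Qed.

Let sX'T : X^`(1)%g \subset T.
Proof.
apply: subset_trans (normal_sub nsNT).
exact: der1_min (normal_norm nsNX) abXN.
Qed.

Let nsTX : T <| X. Proof. exact: sub_der1_normal. Qed.

(** The case y = 1 of [correspondent_twist] reads t x = mu x * t x; after moving
    x within its coset of N, where mu is constant, t x can be cancelled. *)
Lemma mul_mod_Iirr_fixed_Inertia (c : Iirr T) k (mu : Iirr (X / N)) :
    'Res[N] 'chi_c = 'chi_i -> i \in irr_constt ('Res[N] 'chi_k) ->
    mul_mod_Iirr k mu = k ->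
  {in T, forall x, 'chi_mu (coset N x) = 1}.
Proof.
move=> cE ki kmu x Tx.
have [t [tE tk]] := extension_correspondent nsNX abXN cE ki.
have k1: k = mul_mod_Iirr (conjg_Iirr k 1) mu.
  by rewrite conjg_Iirr_inner ?kmu.
have [g Ng nz] := extension_nonvanishing (normal_sub nsNT) tE Tx.
have := correspondent_twist nsNX abXN tE tk (group1 _) (group1 _) k1.
have Tg := subsetP (normal_sub nsNT) g Ng.
move=> /(_ (x * g)%g (groupM Tx Tg)); rewrite invg1 conjg1.
rewrite coset_kerr // => /esym/eqP.
by move/eqP/(canRL (mulfK nz)); rewrite divff.
Qed.

(** A linear character of the abelian group X / T separates x from T; twisting
    by it fixes k, which is induced from the normal subgroup T and so vanishes
    outside T. *)
Lemma notin_Inertia_twist k x :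
    i \in irr_constt ('Res[N] 'chi_k) -> x \in X -> x \notin T ->
  exists2 mu : Iirr (X / N), mul_mod_Iirr k mu = k & 'chi_mu (coset N x) != 1.
Proof.
move=> ki Xx Tx; have nTX := normal_norm nsTX.
have abXT: abelian (X / T) by apply: sub_der1_abelian.
have [m m_x]: exists m : Iirr (X / T), 'chi_m (coset T x) != 1.
  apply/existsP; apply: contraR Tx; rewrite negb_exists => /forallP all1.
  have XTx: coset T x \in (X / T)%g by rewrite mem_quotient.
  apply: coset_idr; rewrite ?(subsetP nTX) //; apply/set1gP.
  rewrite -(TI_cfker_irr (X / T)); apply/bigcapP=> m _.
  rewrite cfkerEirr inE lin_char1; last exact/char_abelianP.
  by rewrite -[_ == _]negbK all1.
have kerT: T \subset cfker 'chi_(mod_Iirr m) by rewrite mod_IirrE // cfker_mod.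
have kerN := subset_trans (normal_sub nsNT) kerT.
have muE z : z \in X ->
    'chi_(quo_Iirr N (mod_Iirr m)) (coset N z) = 'chi_m (coset T z).
  by move=> Xz; rewrite quo_IirrE // cfQuoE // mod_IirrE // cfModE.
exists (quo_Iirr N (mod_Iirr m)); last by rewrite muE.
apply: irr_inj; rewrite mul_mod_IirrE //; apply/cfun_inP=> z Xz.
rewrite cfunE cfModE // muE //.
have [Tz | T'z] := boolP (z \in T).
  by rewrite (coset_id Tz) lin_char1 ?mul1r //; apply/char_abelianP.
have [irrI _ indA _ _] := constt_Inertia_bijection i nsNX.
have: k \in irr_constt ('Ind[X] 'chi_i) by rewrite constt_Ind_Res.
rewrite -indA => /imsetP[s As ->]; rewrite cfIirrE ?irrI //.
by rewrite (cfun_on0 (cfInd_normal _ nsTX) T'z) mulr0.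
Qed.

End Stabilizer.

(** * Intertwining operators between extensions *)

Lemma joint_representations (gT : finGroupType) (X Y N : {group gT})
    (t : Iirr X) (s : Iirr Y) :
    N \subset X -> N \subset Y -> 'Res[N] 'chi_t = 'Res[N] 'chi_s ->
  exists n (rX : mx_representation algC X n) (rY : mx_representation algC Y n),
    [/\ cfRepr rX = 'chi_t, cfRepr rY = 'chi_s & {in N, rX =1 rY}].
Proof.
move=> sNX sNY; have /char_reprP[[n rX] /= ->] := irr_char t.
have /char_reprP[[m rY] /= ->] := irr_char s.
rewrite -!(cfRepr_sub _ sNX) -!(cfRepr_sub _ sNY) => /cfRepr_inj[B eq_nm].
move: rY; case: m / eq_nm B => B rY; rewrite row_free_unit => uB simB.
exists n, rX, (rconj_repr rY uB); split=> //.
  apply/cfun_inP=> y Yy; rewrite !cfunE Yy !mulr1n rconj_mxE.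
  by rewrite mxtrace_mulC mulmxA mulVmx // mul1mx.
by move=> x Nx; rewrite rconj_mxE -[rY x]/(subg_repr rY sNY x) -simB // mulmxK.
Qed.

Section Intertwining.

Variables (gT : finGroupType) (X Y N : {group gT}) (n : nat).
Variables (rX : mx_representation algC X n) (rY : mx_representation algC Y n).
Hypotheses (nsNX : N <| X) (sNY : N \subset Y) (eqN : {in N, rX =1 rY}).
Hypothesis irrN : 'Res[N] (cfRepr rX) \in irr N.

Let sNX : N \subset X. Proof. exact: normal_sub. Qed.

Let absN : mx_absolutely_irreducible (subg_repr rX sNX).
Proof. by apply: irr_repr_abs_irr; rewrite cfRepr_sub. Qed.

Lemma commuting_scalar B :
  {in N, forall g, rX g *m B = B *m rX g} -> is_scalar_mx B.
Proof.
move=> cB; apply: (mx_abs_irr_cent_scalar absN); apply/centgmxP=> g Ng.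
by rewrite -[subg_repr _ _ _]/(rX g) cB.
Qed.

Variable y : gT.
Hypotheses (Yy : y \in Y) (nXy : y \in 'N(X)) (nNy : y \in 'N(N)).

Let Jmem x : x \in X -> (x ^ y^-1)%g \in X.
Proof. by move=> Xx; rewrite memJ_norm ?groupV. Qed.

(** The matrix rX (x ^ y^-1)^-1 * rY y * rX x * rY y^-1 commutes with the image
    of N, hence is scalar by Schur's lemma. *)
Lemma intertwining_scalar x : x \in X ->
  exists a, rY y *m rX x = a *: (rX (x ^ y^-1)%g *m rY y).
Proof.
move=> Xx; set x' := (x ^ y^-1)%g; have Xx' : x' \in X by apply: Jmem.
have swapY g z : g \in N -> z \in Y -> z \in 'N(N) ->
    rY z *m rX g = rX (g ^ z^-1)%g *m rY z.
  move=> Ng Yz nNz; have Ngz: (g ^ z^-1)%g \in N by rewrite memJ_norm ?groupV.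
  have [Yg Ygz] := (subsetP sNY _ Ng, subsetP sNY _ Ngz).
  by rewrite !eqN // -!repr_mxM // /conjg invgK !mulgA mulgKV.
have swapX g z : g \in N -> z \in X ->
    rX z *m rX g = rX (g ^ z^-1)%g *m rX z.
  move=> Ng Xz; have nNz := subsetP (normal_norm nsNX) z Xz.
  have Ngz: (g ^ z^-1)%g \in N by rewrite memJ_norm ?groupV.
  have [Xg Xgz] := (subsetP sNX _ Ng, subsetP sNX _ Ngz).
  by rewrite -!repr_mxM // /conjg invgK !mulgA mulgKV.
pose B := rX x'^-1%g *m (rY y *m (rX x *m rY y^-1%g)).
have /is_scalar_mxP[a Ba]: is_scalar_mx B.
  apply: commuting_scalar => g Ng; have nNx := subsetP (normal_norm nsNX) x Xx.
  have nNx' := subsetP (normal_norm nsNX) x' Xx'.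
  rewrite /B -!mulmxA swapY ?groupV // invgK.
  rewrite [rX x *m (rX _ *m _)]mulmxA swapX ?memJ_norm //.
  rewrite -[_ *m rX x *m _]mulmxA.
  rewrite (mulmxA (rY y) (rX ((g ^ y) ^ x^-1)%g)) swapY ?memJ_norm ?groupV //.
  rewrite -!mulmxA.
  rewrite (mulmxA (rX x'^-1%g) (rX (((g ^ y) ^ x^-1) ^ y^-1)%g)).
  rewrite swapX ?memJ_norm ?groupV //.
  rewrite invgK -!conjgM -!mulmxA.
  suff ->: (y * (x^-1 * (y^-1 * x')) = 1)%g by rewrite conjg1.
  by rewrite /x' /conjg invgK !mulgA mulgKV mulgKV mulgV.
exists a; have := congr1 (fun D => rX x' *m D *m rY y) Ba.
rewrite /B !mulmxA -repr_mxM ?groupV // mulgV repr_mx1 mul1mx -mulmxA.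
by rewrite -repr_mxM ?groupV // mulVg repr_mx1 mulmx1 mul_mx_scalar -scalemxAl.
Qed.

(** Taking traces identifies the scalar of [intertwining_scalar] at every point
    where the character does not vanish, and each coset of N contains such a
    point; the two sides depend in the same way on the choice of this point. *)
Lemma intertwining_twist (la : gT -> algC) :
    {in X & N, forall x g, la (x * g)%g = la x} ->
    {in X, forall x, cfRepr rX x = la x * cfRepr rX (x ^ y^-1)%g} ->
  {in X, forall x, rY y *m rX x = la x *: (rX (x ^ y^-1)%g *m rY y)}.
Proof.
move=> laN laE x Xx; have /irrP[i iE] := irrN.
have irrX: cfRepr rX \in irr X by rewrite (cfRes_irr_irr (cfRepr_char _) irrN).
have /irrP[t tE] := irrX; rewrite tE in iE.
have [g Ng nz] := extension_nonvanishing sNX iE Xx.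
have Xg := subsetP sNX g Ng; have Xxg := groupM Xx Xg.
have xgE: rY y *m rX (x * g)%g =
    la (x * g)%g *: (rX ((x * g) ^ y^-1)%g *m rY y).
  have [a aE] := intertwining_scalar Xxg; rewrite aE; congr (_ *: _).
  have tr_a: 'chi_t (x * g)%g = a * 'chi_t ((x * g) ^ y^-1)%g.
    have := congr1 (fun D => \tr (rY y^-1%g *m D)) aE.
    rewrite mulmxA -repr_mxM ?groupV // mulVg repr_mx1 mul1mx.
    rewrite -scalemxAr mxtraceZ mxtrace_mulC -mulmxA -repr_mxM ?groupV //.
    by rewrite mulgV repr_mx1 mulmx1 -tE !cfunE Jmem // Xxg !mulr1n.
  have := laE _ Xxg; rewrite tE tr_a; apply: mulIf.
  by apply: contraNneq nz => z0; rewrite tr_a z0 mulr0.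
have gE: rX (g ^ y^-1)%g *m rY y = rY y *m rX g.
  have Ngy: (g ^ y^-1)%g \in N by rewrite memJ_norm ?groupV.
  have [Yg Ygy] := (subsetP sNY _ Ng, subsetP sNY _ Ngy).
  by rewrite !eqN // -!repr_mxM // /conjg invgK !mulgA mulgKV.
rewrite laN // conjMg (repr_mxM rX Xx Xg) in xgE.
rewrite (repr_mxM rX (Jmem Xx) (Jmem Xg)) in xgE.
rewrite -(mulmxA (rX _)) gE in xgE.
have := congr1 (fun D => D *m rX g^-1%g) xgE.
rewrite /= -scalemxAl -!mulmxA -repr_mxM ?groupV // mulgV repr_mx1 !mulmx1.
by [].
Qed.

End Intertwining.

(** * Projective representations of a product of two groups *)

(** The functions d and r choose a factorization a = d a * r a with d a in X and
    r a in Y. They are parameters because the representations of A and of its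
    subgroup H are to be built from the same factorization of the elements of H,
    which makes their factor sets comparable. *)
Definition product_repr (gT : finGroupType) (X Y : {group gT}) n
    (rX : mx_representation algC X n) (rY : mx_representation algC Y n)
    (d r : gT -> gT) (a : gT) : 'M[algC]_n :=
  rX (d a) *m rY (r a).

Section ProductRepr.

Variables (gT : finGroupType) (A X Y N : {group gT}) (n : nat).
Variables (rX : mx_representation algC X n) (rY : mx_representation algC Y n).
Variables (d r : gT -> gT) (la : gT -> gT -> algC).
Hypotheses (defA : (X * Y)%g = A) (nXA : A \subset 'N(X)) (tiXY : X :&: Y = N).
Hypothesis drE :
  {in A, forall a, [/\ d a \in X, r a \in Y & a = (d a * r a)%g]}.
Hypothesis eqN : {in N, rX =1 rY}.

Let P := product_repr rX rY d r.
Let sYA : Y \subset A. Proof. by rewrite -defA mulG_subr. Qed.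
Let sNX : N \subset X. Proof. by rewrite -tiXY subsetIl. Qed.
Let sNY : N \subset Y. Proof. by rewrite -tiXY subsetIr. Qed.

Lemma product_reprE x y : x \in X -> y \in Y -> P (x * y)%g = rX x *m rY y.
Proof.
move=> Xx Yy; have Axy: (x * y)%g \in A by rewrite -defA mem_mulg.
have [Xd Yr] := drE Axy; set a := (x * y)%g in Xd Yr * => aE.
have zE: (x^-1 * d a = y * (r a)^-1)%g.
  by apply: (mulIg (r a)); rewrite mulgKV -mulgA -aE mulKg.
have Nz: (x^-1 * d a)%g \in N.
  by rewrite -tiXY inE {2}zE !groupM ?groupV.
rewrite /P /product_repr -{1}(mulKVg x (d a)) repr_mxM ?groupM ?groupV //.
rewrite (eqN Nz) zE repr_mxM ?groupV // -!mulmxA -repr_mxM ?groupV //.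
by rewrite mulVg repr_mx1 mulmx1.
Qed.

Lemma product_reprX x : x \in X -> P x = rX x.
Proof.
by move=> Xx; rewrite -[x in P x]mulg1 product_reprE // repr_mx1 mulmx1.
Qed.

Lemma product_reprY y : y \in Y -> P y = rY y.
Proof.
by move=> Yy; rewrite -[y in P y]mul1g product_reprE // repr_mx1 mul1mx.
Qed.

(** Moving rY (r a) across rX (d b) costs the scalar la (r a) (d b), and this is
    the whole factor set. *)
Lemma product_repr_projective :
    {in Y & X, forall y x, la y x != 0 /\
       rY y *m rX x = la y x *: (rX (x ^ y^-1)%g *m rY y)} ->
  projective_repr A P (fun a b => la (r a) (d b)).
Proof.
move=> laE; split=> [a /drE[Xd Yr _] | a b Aa Ab].
  by rewrite unitmx_mul !repr_mx_unit.
have [[Xda Yra aE] [Xdb Yrb bE]] := (drE Aa, drE Ab).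
have [-> twE] := laE _ _ Yra Xdb; split=> //.
have Xdb': (d b ^ (r a)^-1)%g \in X.
  by rewrite memJ_norm ?groupV ?(subsetP nXA) ?(subsetP sYA).
have ->: (a * b = d a * d b ^ (r a)^-1 * (r a * r b))%g.
  by rewrite {1}aE {1}bE /conjg invgK !mulgA mulgKV.
rewrite (product_reprE (groupM Xda Xdb') (groupM Yra Yrb)).
rewrite (repr_mxM rX Xda Xdb') (repr_mxM rY Yra Yrb).
rewrite /P /product_repr !mulmxA -(mulmxA (rX (d a)) (rY (r a))) twE.
by rewrite -scalemxAr -!scalemxAl !mulmxA.
Qed.

Lemma product_repr_associated i :
  'Res[N] (cfRepr rX) = 'chi[N]_i -> associated_to A 'chi_i P.
Proof.
move=> resN; split.
- exists (subg_repr rX sNX); last by rewrite cfRepr_sub.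
  by move=> g Ng; rewrite product_reprX ?(subsetP sNX).
- move=> g a Ng Aa; have [Xd Yr aE] := drE Aa; have Xg := subsetP sNX g Ng.
  rewrite {1}aE mulgA product_reprE ?groupM // repr_mxM // -mulmxA.
  by rewrite (product_reprX Xg).
move=> g a Ng Aa; have [Xd Yr aE] := drE Aa; have Yg := subsetP sNY g Ng.
rewrite {1}aE -mulgA product_reprE ?groupM // repr_mxM // mulmxA.
by rewrite (product_reprY Yg).
Qed.

End ProductRepr.

(** The two intertwining scalars are given by one function la, so both factor
    sets are la (r a) (d b) once elements of H are factored inside H. *)
Lemma ge_c_products (gT : finGroupType) (A G H M X Y X' Y' : {group gT})
    (i : Iirr G) (j : Iirr M) n n'
    (rX : mx_representation algC X n) (rY : mx_representation algC Y n)
    (rX' : mx_representation algC X' n') (rY' : mx_representation algC Y' n')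
    (la : gT -> gT -> algC) :
    G <| A -> A \subset 'I['chi_i] ->
    H \subset A -> (G * H)%g = A -> 'C_A(G) \subset H ->
    G :&: H = M -> H \subset 'I['chi_j] ->
    (X * Y)%g = A -> A \subset 'N(X) -> X :&: Y = G ->
    (X' * Y')%g = H -> H \subset 'N(X') -> X' :&: Y' = M ->
    X' \subset X -> Y' \subset Y ->
    'Res[G] (cfRepr rX) = 'chi_i -> {in G, rX =1 rY} ->
    'Res[M] (cfRepr rX') = 'chi_j -> {in M, rX' =1 rY'} ->
    {in Y & X, forall y x, la y x != 0 /\
       rY y *m rX x = la y x *: (rX (x ^ y^-1)%g *m rY y)} ->
    {in Y' & X', forall y x,
       rY' y *m rX' x = la y x *: (rX' (x ^ y^-1)%g *m rY' y)} ->
    {in 'C_A(G), forall c, exists x y, [/\ x \in X', y \in Y', c = (x * y)%g,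
       exists a, rX x = a%:M /\ rX' x = a%:M &
       exists b, rY y = b%:M /\ rY' y = b%:M]} ->
  ge_c A i H j.
Proof.
move=> nsGA IA sHA GH sCH tiGH IH defA nXA tiXY defH nX'H tiX'Y' sX'X sY'Y.
move=> resG eqG resM eqM laE laE' cE; split=> //.
pose d a := if a \in H then divgr X' Y' a else divgr X Y a.
pose r a := if a \in H then remgr X' Y' a else remgr X Y a.
have drH: {in H, forall a, [/\ d a \in X', r a \in Y' & a = (d a * r a)%g]}.
  move=> a Ha; rewrite /d /r Ha; split; last exact: divgr_eq.
    by rewrite mem_divgr ?defH.
  by rewrite mem_remgr ?defH.
have drA: {in A, forall a, [/\ d a \in X, r a \in Y & a = (d a * r a)%g]}.
  move=> a Aa; have [/drH[X'd Y'r aE] | H'a] := boolP (a \in H).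
    by rewrite (subsetP sX'X) ?(subsetP sY'Y).
  rewrite /d /r (negPf H'a); split; last exact: divgr_eq.
    by rewrite mem_divgr ?defA.
  by rewrite mem_remgr ?defA.
exists n, (product_repr rX rY d r), (fun a b => la (r a) (d b)).
exists n', (product_repr rX' rY' d r), (fun a b => la (r a) (d b)).
split=> //.
- split; first exact: product_repr_projective defA nXA tiXY drA eqG laE.
  exact: product_repr_associated defA tiXY drA eqG _ resG.
- split; last exact: product_repr_associated defH tiX'Y' drH eqM _ resM.
  apply: product_repr_projective defH nX'H tiX'Y' drH eqM _.
  move=> y x Y'y X'x; split; last exact: laE'.
  by have [] := laE _ _ (subsetP sY'Y y Y'y) (subsetP sX'X x X'x).
move=> c /cE[x [y [X'x Y'y -> [a [Xa X'a]] [b [Yb Y'b]]]]]; exists (a * b).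
rewrite (product_reprE defA tiXY drA) ?(subsetP sX'X) ?(subsetP sY'Y) //.
rewrite (product_reprE defH tiX'Y' drH) //.
by rewrite Xa X'a Yb Y'b -!scalar_mxM.
Qed.

(** * Conjugating character triples *)

Lemma mx_reprJ (gT : finGroupType) (N : {group gT}) n
    (rN : mx_representation algC N n) y :
  y \in 'N(N) -> mx_repr N (fun x => rN (x ^ y^-1)%g).
Proof.
move=> nNy; split=> [|x z Nx Nz]; first by rewrite conj1g repr_mx1.
by rewrite conjMg repr_mxM ?memJ_norm ?groupV.
Qed.

Lemma projective_reprJ (gT : finGroupType) (A : {group gT}) n
    (P : gT -> 'M[algC]_n) alpha y :
    projective_repr A P alpha ->
  projective_repr (A :^ y)%G (fun a => P (a ^ y^-1)%g)
                  (fun a b => alpha (a ^ y^-1)%g (b ^ y^-1)%g).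
Proof.
case=> uP PM; split=> [a | a b]; rewrite !mem_conjg; first exact: uP.
by move=> Aa Ab; rewrite conjMg; apply: PM.
Qed.

Lemma associated_toJ (gT : finGroupType) (A N : {group gT}) i n
    (P : gT -> 'M[algC]_n) y :
    y \in 'N(N) -> associated_to A 'chi[N]_i P ->
  associated_to (A :^ y)%G 'chi_(conjg_Iirr i y) (fun a => P (a ^ y^-1)%g).
Proof.
move=> nNy [[rN PE rNE] Pl Pr]; split.
- exists (MxRepresentation (mx_reprJ rN nNy)) => [x Nx | ].
    by rewrite PE ?memJ_norm ?groupV.
  apply/cfun_inP=> x Nx; rewrite conjg_IirrE cfConjgE // -rNE !cfunE.
  by rewrite Nx memJ_norm ?groupV // Nx.
- move=> x a Nx; rewrite mem_conjg => Aa.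
  by rewrite conjMg; apply: Pl => //; rewrite memJ_norm ?groupV.
move=> x a Nx; rewrite mem_conjg => Aa.
by rewrite conjMg; apply: Pr => //; rewrite memJ_norm ?groupV.
Qed.

Lemma ge_cJ (gT : finGroupType) (A G H M : {group gT}) (i : Iirr G)
    (j : Iirr M) y :
    y \in 'N(G) -> y \in 'N(M) -> ge_c A i H j ->
  ge_c (A :^ y)%G (conjg_Iirr i y) (H :^ y)%G (conjg_Iirr j y).
Proof.
move=> nGy nMy [[nsGA IA] [sHA GH sCH] [tiGH IH]].
case=> n [P [al [n' [P' [al' [[pP aP] [pP' aP'] alE cE]]]]]].
have defG: (G :^ y = G)%g by apply: normP.
have sCJ: 'C_(A :^ y)(G) = 'C_A(G) :^ y by rewrite conjIg -centJ defG.
split.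
- by rewrite -{1}defG normalJ conjg_IirrE -conjg_inertia // conjSg.
- rewrite sCJ !conjSg; split=> //; first by rewrite -{1}defG -conjsMg GH.
- split; last by rewrite conjg_IirrE -conjg_inertia // conjSg.
  by rewrite -{1}defG -conjIg tiGH (normP nMy).
exists n, (fun a => P (a ^ y^-1)%g), (fun a b => al (a ^ y^-1)%g (b ^ y^-1)%g).
exists n', (fun a => P' (a ^ y^-1)%g).
exists (fun a b => al' (a ^ y^-1)%g (b ^ y^-1)%g); split.
- by split; [apply: projective_reprJ | apply: associated_toJ].
- by split; [apply: projective_reprJ | apply: associated_toJ].
- by move=> a b; rewrite !mem_conjg; apply: alE.
by move=> c; rewrite sCJ mem_conjg; apply: cE.
Qed.

(** * Scalar subgroups and central characters *)

Lemma scalar_constt_Res (gT : finGroupType) (X C : {group gT}) n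
    (rX : mx_representation algC X n) (nu : Iirr C) :
    C \subset X -> {in C, forall z, is_scalar_mx (rX z)} ->
    nu \in irr_constt ('Res[C] (cfRepr rX)) ->
  {in C, forall z, rX z = ('chi_nu z)%:M}.
Proof.
move=> sCX scC; set chi := cfRepr rX => nuP z Cz.
have sCZ: C \subset 'Z(chi)%CF.
  rewrite cfcenter_repr; apply/subsetP=> x Cx.
  by rewrite inE (subsetP sCX) ?scC.
have [chi1 lin1 chi1E] := cfcenter_Res chi.
have /irrP[m mE]: 'Res[C] chi1 \in irr C.
  exact/lin_char_irr/cfRes_lin_char.
have resE: 'Res[C] chi = n%:R *: 'chi_m.
  have := congr1 (fun phi => 'Res[C] phi) chi1E.
  by rewrite cfResRes ?cfcenter_sub // linearZ /= mE cfRepr1.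
have [nz Dm]: n%:R != 0 :> algC /\ m = nu.
  move: nuP; rewrite irr_consttE resE cfdotZl cfdot_irr mulf_eq0 negb_or.
  by case: (m =P nu) => [-> /andP[] | _]; rewrite ?eqxx ?andbF.
have /is_scalar_mxP[a aE] := scC z Cz; rewrite aE; congr _%:M.
have := congr1 (fun phi : 'CF(C) => phi z) resE.
rewrite cfResE // !cfunE (subsetP sCX) //= mulr1n aE mxtrace_scalar Dm.
by rewrite -[a *+ n]mulr_natl => /(mulfI nz).
Qed.

(** C is central in X, so a single character of C lies under k, and the
    constituents of t restricted to C are among those of k. *)
Lemma central_scalar_Ind (gT : finGroupType) (X T C : {group gT}) n
    (rT : mx_representation algC T n) (t : Iirr T) (k : Iirr X) (nu : Iirr C) :
    T \subset X -> C \subset 'Z(X) -> C \subset T -> cfRepr rT = 'chi_t ->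
    'Ind[X] 'chi_t = 'chi_k -> nu \in irr_constt ('Res[C] 'chi_k) ->
  {in C, forall z, rT z = ('chi_nu z)%:M}.
Proof.
move=> sTX sCZ sCT tE tk nuk.
have scal (Y : {group gT}) m (rY : mx_representation algC Y m) :
    Y \subset X -> C \subset Y -> cfRepr rY \in irr Y ->
    {in C, forall z, is_scalar_mx (rY z)}.
  move=> sYX sCY irrY z Cz; have [Xz cXz] := setIP (subsetP sCZ z Cz).
  apply: (mx_abs_irr_cent_scalar (irr_repr_abs_irr irrY)).
  apply/centgmxP=> y Yy; have Yz := subsetP sCY z Cz.
  by rewrite -!repr_mxM // (centP cXz) ?(subsetP sYX).
have sCX := subset_trans sCT sTX.
have scT: {in C, forall z, is_scalar_mx (rT z)}.
  by apply: scal; rewrite ?tE ?mem_irr.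
have [nu' nu't] := constt_cfRes_irr C t.
have /char_reprP[[m rK] /= kE] := irr_char k.
have scK: {in C, forall z, is_scalar_mx (rK z)}.
  by apply: scal; rewrite -?kE ?mem_irr.
have nu'k: nu' \in irr_constt ('Res[C] 'chi_k).
  have tk1: t \in irr_constt ('Res[T] 'chi_k).
    by rewrite -constt_Ind_Res tk constt_irr inE.
  rewrite -(cfResRes _ sCT sTX).
  by apply: constt_Res_trans nu't; rewrite ?cfRes_char ?irr_char.
rewrite kE in nuk nu'k; suff <-: nu' = nu.
  by apply: scalar_constt_Res; rewrite ?tE.
apply/irr_inj/cfun_inP=> z Cz.
have := scalar_constt_Res sCX scK nu'k Cz.
rewrite (scalar_constt_Res sCX scK nuk Cz) => /(congr1 mxtrace)/eqP.
rewrite !mxtrace_scalar -subr_eq0 -mulrnBl mulrn_eq0 subr_eq0.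
have /negPf->/= : m != 0%N.
  by have := irr1_neq0 k; rewrite kE cfRepr1 pnatr_eq0.
by move/eqP.
Qed.

(** * Matching linear characters *)

(** The second isomorphism theorem, with explicit values. *)
Lemma matching_isom (gT : finGroupType) (X G Y M : {group gT}) :
    G <| X -> (G * Y)%g = X -> G :&: Y = M ->
  exists2 f : {morphism (Y / M)%g >-> coset_of G}, isom (Y / M)%g (X / G)%g f &
    {in Y, forall x, f (coset M x) = coset G x}.
Proof.
move=> nsGX defX tiM; have sYX: Y \subset X by rewrite -defX mulG_subr.
have nGY := subset_trans sYX (normal_norm nsGX).
have defM: M = (G :&: Y)%G by apply: val_inj; rewrite /= tiM.
rewrite {M tiM}defM /=; have [f injf fE] := second_isom nGY.
exists f => [|x Yx].
  apply/isomP; split=> //; rewrite fE //= -defX.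
  by rewrite quotientMl ?normG // trivg_quotient mul1g.
have nMx: x \in 'N(G :&: Y).
  apply: subsetP x Yx; apply: normsI (nGY) (normG _).
have := fE [set x]; rewrite sub1set => /(_ Yx).
rewrite !quotient_set1 ?(subsetP nGY) //.
rewrite morphim_set1 ?mem_quotient // => fxE.
by apply/set1P; rewrite -fxE set11.
Qed.

Section Matching.

Variables (gT : finGroupType) (X G Y M : {group gT}).
Hypotheses (nsGX : G <| X) (defX : (G * Y)%g = X) (tiM : G :&: Y = M).

Lemma matching_chars_down (mu : Iirr (X / G)) :
  exists la : Iirr (Y / M), matching_chars mu la.
Proof.
have [f isof fE] := matching_isom nsGX defX tiM.
exists (isom_Iirr (isom_sym isof) mu) => x Yx.
rewrite -{1}(isom_IirrKV isof mu) isom_IirrE -fE // cfIsomE //.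
by rewrite mem_quotient.
Qed.

Lemma matching_chars_up (la : Iirr (Y / M)) :
  exists mu : Iirr (X / G), matching_chars mu la.
Proof.
have [f isof fE] := matching_isom nsGX defX tiM.
exists (isom_Iirr isof la) => x Yx.
by rewrite isom_IirrE -fE // cfIsomE // mem_quotient.
Qed.

End Matching.

(** * The relation between the triples of a corresponding pair *)

(** In the application Z and C are Z(Gc) and C_E(G), and Omegac takes k to k';
    all that is used of its equivariance is the hypothesis twist. *)
Section CorrespondingPair.

Variables (gT : finGroupType) (A Gc GE G H Mc Mh M Z C : {group gT}).
Hypotheses (nsGA : G <| A) (nsGcA : Gc <| A) (sGEA : GE \subset A).
Hypotheses (nsGGc : G <| Gc) (abG : abelian (Gc / G)) (sGGE : G \subset GE).
Hypothesis tiG : Gc :&: GE = G.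
Hypotheses (sHA : H \subset A) (GH : (G * H)%g = A) (tiM : G :&: H = M).
Hypotheses (nMcH : H \subset 'N(Mc)) (sMcH : Mc \subset H).
Hypothesis sMhH : Mh \subset H.
Hypotheses (GMc : (G * Mc)%g = Gc) (sMhGE : Mh \subset GE).
Hypotheses (nsMMc : M <| Mc) (abM : abelian (Mc / M)) (sMMh : M \subset Mh).
Hypotheses (defCA : 'C_A(G) = (Z * C)%g) (sZZ : Z \subset 'Z(Gc)).
Hypotheses (sZMc : Z \subset Mc) (sCMh : C \subset Mh).

Variables (i : Iirr G) (j : Iirr M) (k : Iirr Gc) (k' : Iirr Mc).
Hypothesis Iij : 'I_H['chi_i] = 'I_H['chi_j].
Hypothesis defAi : ('I_Gc['chi_i] * 'I_GE['chi_i])%g = 'I_A['chi_i].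
Hypothesis defHj : ('I_Mc['chi_j] * 'I_Mh['chi_j])%g = 'I_H['chi_j].
Hypotheses (ki : i \in irr_constt ('Res[G] 'chi_k)).
Hypotheses (kj : j \in irr_constt ('Res[M] 'chi_k')).
Variables (c : Iirr 'I_Gc['chi_i]) (c' : Iirr 'I_Mc['chi_j]).
Variables (s : Iirr 'I_GE['chi_i]) (s' : Iirr 'I_Mh['chi_j]).
Hypotheses (cE : 'Res[G] 'chi_c = 'chi_i) (cE' : 'Res[M] 'chi_c' = 'chi_j).
Hypotheses (sE : 'Res[G] 'chi_s = 'chi_i) (sE' : 'Res[M] 'chi_s' = 'chi_j).
Hypothesis twist : forall y (mu : Iirr (Gc / G)) (la : Iirr (Mc / M)),
  y \in Mh -> matching_chars mu la -> k = mul_mod_Iirr (conjg_Iirr k y) mu ->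
  k' = mul_mod_Iirr (conjg_Iirr k' y) la.
Variable nu : Iirr Z.
Hypotheses (nuk : nu \in irr_constt ('Res[Z] 'chi_k)).
Hypotheses (nuk' : nu \in irr_constt ('Res[Z] 'chi_k')).
Hypothesis underC : Irr_under C 'chi_s = Irr_under C 'chi_s'.

(** The y-conjugate of k lies over the same i as k. *)
Lemma twist_exists y : y \in A -> y \in 'I['chi_i] ->
  exists mu : Iirr (Gc / G), k = mul_mod_Iirr (conjg_Iirr k y) mu.
Proof.
move=> Ay Iy; apply: abelian_quotient_transitive ki => //.
rewrite -{1}(conjg_Iirr_inertia Iy) irr_constt_Res_conjg //.
  exact: subsetP (normal_norm nsGcA) y Ay.
exact: subsetP (normal_norm nsGA) y Ay.
Qed.

Lemma ge_c_correspondents : ge_c 'I_A['chi_i]%G i 'I_H['chi_j]%G j.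
Proof.
have sMcGc: Mc \subset Gc by rewrite -GMc mulG_subr.
have tiGMc: G :&: Mc = M.
  apply/eqP; rewrite eqEsubset -{1}tiM setIS //=.
  by rewrite subsetI (normal_sub nsMMc) -tiM subsetIl.
have sMH: M \subset H by rewrite -tiM subsetIr.
have [t [tE tk]] := extension_correspondent nsGGc abG cE ki.
have [t' [tE' tk']] := extension_correspondent nsMMc abM cE' kj.
have sGX: G \subset 'I_Gc['chi_i] by apply/sub_Inertia/normal_sub.
have sGY: G \subset 'I_GE['chi_i] by apply/sub_Inertia.
have sMX': M \subset 'I_Mc['chi_j] by apply/sub_Inertia/normal_sub.
have sMY': M \subset 'I_Mh['chi_j] by apply/sub_Inertia.
have [|n [rX [rY [rXE rYE eqG]]]] :=
  @joint_representations _ 'I_Gc['chi_i]%G 'I_GE['chi_i]%G G t s sGX sGY.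
  by rewrite tE sE.
have [|n' [rX' [rY' [rXE' rYE' eqM]]]] :=
  @joint_representations _ 'I_Mc['chi_j]%G 'I_Mh['chi_j]%G M t' s' sMX' sMY'.
  by rewrite tE' sE'.
(* One choice of mu for each y serves both triples: locally it is replaced by
   the matching la. *)
have [m mE]: exists m : gT -> Iirr (Gc / G), forall y, y \in 'I_A['chi_i] ->
    k = mul_mod_Iirr (conjg_Iirr k y) (m y).
  apply: (@fin_all_exists _ _ (fun y mu => y \in 'I_A['chi_i] ->
            k = mul_mod_Iirr (conjg_Iirr k y) mu)) => y.
  have [/setIP[Ay Iy] | _] := boolP (y \in 'I_A['chi_i]); last by exists 0.
  by have [mu muE] := twist_exists Ay Iy; exists mu.
pose la y x := 'chi_(m y) (coset G x).
have linm y : 'chi_(m y) \is a linear_char by apply/char_abelianP.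
have sHjAi: 'I_H['chi_j] \subset 'I_A['chi_i] by rewrite -Iij setSI.
have sX'X: 'I_Mc['chi_j] \subset 'I_Gc['chi_i].
  apply/subsetP=> x /setIP[Mcx Ix].
  have /setIP[_ Ix']: x \in 'I_H['chi_i] by rewrite Iij inE (subsetP sMcH).
  by rewrite inE (subsetP sMcGc).
have sY'Y: 'I_Mh['chi_j] \subset 'I_GE['chi_i].
  apply/subsetP=> x /setIP[Mhx Ix].
  have /setIP[_ Ix']: x \in 'I_H['chi_i] by rewrite Iij inE (subsetP sMhH).
  by rewrite inE (subsetP sMhGE).
have sCG: C \subset 'C(G).
  apply: subset_trans (_ : 'C_A(G) \subset _); last exact: subsetIr.
  by rewrite defCA mulG_subr.
have sZCG: Z \subset 'C(G).
  apply: subset_trans (_ : 'C_A(G) \subset _); last exact: subsetIr.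
  by rewrite defCA mulG_subl.
have sMG: M \subset G by rewrite -tiM subsetIl.
have sCGj: 'C(G) \subset 'I['chi_j].
  exact: subset_trans (centS sMG) (cent_sub_inertia _).
have sZX': Z \subset 'I_Mc['chi_j].
  by rewrite subsetI sZMc (subset_trans sZCG).
have sCY': C \subset 'I_Mh['chi_j].
  by rewrite subsetI sCMh (subset_trans sCG).
have irrX: 'Res[G] (cfRepr rX) \in irr G by rewrite rXE tE mem_irr.
have irrY: 'Res[G] (cfRepr rY) \in irr G by rewrite rYE sE mem_irr.
have irrX': 'Res[M] (cfRepr rX') \in irr M by rewrite rXE' tE' mem_irr.
have irrY': 'Res[M] (cfRepr rY') \in irr M by rewrite rYE' sE' mem_irr.
apply: (ge_c_products (X := 'I_Gc['chi_i]%G) (Y := 'I_GE['chi_i]%G)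
  (X' := 'I_Mc['chi_j]%G) (Y' := 'I_Mh['chi_j]%G)
  (rX := rX) (rY := rY) (rX' := rX') (rY' := rY') (la := la)) => //.
- by apply: normal_Inertia; apply: normal_sub.
- exact: subsetIr.
- by rewrite /= -Iij group_modl ?sub_inertia // GH.
- rewrite /= -defHj; apply: subset_trans (mulgSS sZX' sCY').
  by rewrite -defCA setSI // subsetIl.
- by rewrite /= setIA tiM; apply/setIidPl/sub_inertia.
- exact: subsetIr.
- apply/subsetP=> x /setIP[Ax Ix]; apply: norm_Inertia_irr Ix.
  exact: subsetP (normal_norm nsGcA) x Ax.
- by rewrite /= setIACA setIid tiG; apply/setIidPl/sub_inertia.
- apply/subsetP=> x /setIP[Hx Ix]; apply: norm_Inertia_irr Ix.
  exact: subsetP nMcH x Hx.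
- rewrite /= setIACA setIid; apply/eqP; rewrite eqEsubset; apply/andP; split.
    have tiMM: Mc :&: Mh \subset M.
      by rewrite -tiM -tiG subsetI setISS // subIset // sMcH.
    exact: subset_trans (subsetIl _ _) tiMM.
  by rewrite !subsetI sub_inertia (normal_sub nsMMc) sMMh.
- by rewrite rXE.
- by rewrite rXE'.
- move=> y x /setIP[GEy Iy] Xx; have Ay := subsetP sGEA y GEy.
  have nGcy := subsetP (normal_norm nsGcA) y Ay.
  have nGy := subsetP (normal_norm nsGA) y Ay.
  have Gcx := subsetP (Inertia_sub _ _) x Xx.
  split; first by rewrite lin_char_neq0 // mem_quotient.
  apply: (intertwining_twist _ sGY) => //; last 1 first.
  - rewrite rXE; apply: (correspondent_twist _ _ tE tk nGcy Iy) => //.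
    by apply: mE; apply/setIP; split.
  - exact: normal_Inertia (normal_sub nsGGc).
  - by apply/setIP; split.
  - exact: norm_Inertia_irr Iy.
  by move=> z g _ Gg; rewrite /la coset_kerr.
- move=> y x Y'y X'x; have /setIP[GEy Iy] := subsetP sY'Y y Y'y.
  have /setIP[Mhy Ijy] := Y'y.
  have Ay := subsetP sGEA y GEy; have Hy := subsetP sMhH y Mhy.
  have nMcy := subsetP nMcH y Hy.
  have nMy := subsetP (norm_inertia _) y Ijy.
  have [mu' mumu'] := matching_chars_down nsGGc GMc tiGMc (m y).
  have laE: {in Mc, forall z, la y z = 'chi_mu' (coset M z)}.
    by move=> z Mcz; rewrite /la mumu'.
  apply: (intertwining_twist _ sMY') => //; last 1 first.
  - move=> z X'z; rewrite laE ?(subsetP (Inertia_sub _ _) z X'z) // rXE'.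
    apply: (correspondent_twist _ _ tE' tk' nMcy Ijy) X'z => //.
    by apply: (twist Mhy mumu'); apply: mE; apply/setIP; split.
  - exact: normal_Inertia (normal_sub nsMMc).
  - exact: norm_Inertia_irr Ijy.
  by move=> z g _ Mg; rewrite /la coset_kerr ?(subsetP sMG).
move=> x /setIP[/setIP[Ax _] cGx].
have /mulsgP[z e Zz Ce ->]: x \in (Z * C)%g by rewrite -defCA inE Ax.
exists z, e; split=> //; first exact: subsetP Zz.
- exact: subsetP Ce.
- exists ('chi_nu z); split.
    apply: central_scalar_Ind rXE tk nuk _ Zz => //; first exact: subsetIl.
    exact: subset_trans sX'X.
  apply: central_scalar_Ind rXE' tk' nuk' _ Zz => //; first exact: subsetIl.
  rewrite subsetI sZMc; apply: subset_trans sZZ _.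
  by rewrite subIset // (centS sMcGc) orbT.
(* The values of a constituent common to both extensions are the scalars. *)
have [nu' nu's] := constt_cfRes_irr C s.
have nu's': nu' \in irr_constt ('Res[C] 'chi_s').
  have: nu' \in Irr_under C 'chi_s by rewrite inE.
  by rewrite underC inE.
exists ('chi_nu' e); split.
  apply: scalar_constt_Res Ce => //; rewrite ?rYE //.
    exact: subset_trans sCY' sY'Y.
  move=> w Cw; apply: (commuting_scalar (normal_Inertia _ sGGE) irrY).
  move=> g Gg; have Yg := subsetP sGY g Gg.
  have Yw := subsetP sY'Y w (subsetP sCY' w Cw).
  by rewrite -!repr_mxM // (centP (subsetP sCG w Cw)).
apply: scalar_constt_Res Ce => //; rewrite ?rYE' //.
move=> w Cw; apply: (commuting_scalar (normal_Inertia _ sMMh) irrY').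
move=> g Mg; have Yg := subsetP sMY' g Mg.
have Yw := subsetP sCY' w Cw.
by rewrite -!repr_mxM // (centP (subsetP sCG w Cw)) // (subsetP sMG).
Qed.

End CorrespondingPair.

(** * The action of automorphisms and Galois elements *)

Section GaloisAction.

Variables (gT : finGroupType) (X : {group gT}).
Implicit Types (s t : galQab) (i : Iirr X) (p q : gT * galQab).

(** The values on a subgroup of X are sums of roots of unity of order dividing
    #|X|, so one automorphism of algC represents s on all subgroups at once.
    This gives access to the compatibility of automorphisms of algC with scalar
    products and restriction, whereas s acts on Q^ab only. *)
Lemma gal_Iirr_aut s : exists u : {rmorphism algC -> algC},
  forall (N : {group gT}) (i : Iirr N),
    N \subset X -> gal_Iirr s i = aut_Iirr u i.
Proof.
have [u Du] := gal_app_unity_root s (cardG_gt0 X).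
exists u => N i sNX; apply: irr_inj; rewrite gal_IirrE aut_IirrE.
apply/cfun_inP=> x Nx; rewrite !cfunE.
have [n [e [e1 ->]]] := irr_unity_sum i Nx.
have eX l : e 0 l ^+ #|X| = 1.
  by have /dvdnP[m ->] := cardSg sNX; rewrite mulnC exprM e1 expr1n.
rewrite gal_app_sum ?rmorph_sum => [|l]; last exact: unity_root_Qab (eX l).
by apply: eq_bigr => l _; rewrite Du.
Qed.

Lemma gal_Iirr1 i : gal_Iirr 1%g i = i.
Proof.
apply: irr_inj; rewrite gal_IirrE; apply/cfunP=> x; rewrite cfunE.
by rewrite -['chi_i x]/(val (MkQab (irr_Qab i x))) gal_app_val.
Qed.

Lemma gal_IirrM s t i : gal_Iirr (s * t)%g i = gal_Iirr t (gal_Iirr s i).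
Proof.
apply: irr_inj; rewrite !gal_IirrE; apply/cfunP=> x; rewrite !cfunE.
by rewrite -['chi_i x]/(val (MkQab (irr_Qab i x))) !gal_app_val.
Qed.

Lemma gal_conjg_Iirr s i y :
  gal_Iirr s (conjg_Iirr i y) = conjg_Iirr (gal_Iirr s i) y.
Proof.
have [u uE] := gal_Iirr_aut s; apply: irr_inj.
by rewrite !uE // aut_IirrE !conjg_IirrE aut_IirrE cfAutConjg.
Qed.

Lemma act_Iirr_conjg i y : act_Iirr i (y, 1%g) = conjg_Iirr i y.
Proof. by rewrite /act_Iirr gal_Iirr1. Qed.

Lemma act_IirrM i p q : p.1 \in 'N(X) -> q.1 \in 'N(X) ->
  act_Iirr i (p * q)%g = act_Iirr (act_Iirr i p) q.
Proof.
move=> nXp nXq; have ->: (p * q)%g = (p.1 * q.1, p.2 * q.2)%g by [].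
by rewrite /act_Iirr gal_IirrM conjg_IirrM // !gal_conjg_Iirr.
Qed.

Lemma irr_constt_Res_act (N : {group gT}) (i : Iirr N) (k : Iirr X) p :
    N \subset X -> p.1 \in 'N(X) -> p.1 \in 'N(N) ->
  (act_Iirr i p \in irr_constt ('Res[N] 'chi_(act_Iirr k p))) =
  (i \in irr_constt ('Res[N] 'chi_k)).
Proof.
move=> sNX nXp nNp; rewrite -[RHS](irr_constt_Res_conjg i k nXp nNp).
rewrite /act_Iirr; have [u uE] := gal_Iirr_aut p.2.
rewrite !irr_consttE !uE // !aut_IirrE -cfAutRes cfdot_aut_char ?irr_char //.
by rewrite fmorph_eq0.
Qed.

End GaloisAction.

(** * Transversals *)

(** An element of J is required because the function must be total on I. *)
Lemma bijection_of_relation (I J : finType) (S : {set I}) (T : {set J})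
    (R : I -> J -> Prop) :
    {in S, forall i, exists2 j, j \in T & R i j} ->
    {in T, forall j, exists2 i, i \in S & R i j} ->
    (forall i j j', R i j -> R i j' -> j = j') ->
    (forall i i' j, R i j -> R i' j -> i = i') -> 
    (exists j : J, true) ->
  exists2 f : I -> J, bij_on S T f & {in S, forall i, R i (f i)}.
Proof.
move=> totR surR funR injR [j0 _].
have [f fE]: exists f : I -> J, forall i, i \in S -> f i \in T /\ R i (f i).
  apply: (@fin_all_exists _ _ (fun i j => i \in S -> j \in T /\ R i j)) => i.
  have [/totR[j Tj Rij] | _] := boolP (i \in S); last by exists j0.
  by exists j.
exists f => [|i /fE[]//]; split=> [i i' Si Si' eqf | ].
  have [_ Ri] := fE i Si; have [_ Ri'] := fE i' Si'.
  by apply: injR Ri _; rewrite eqf.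
apply/setP=> j; apply/imsetP/idP=> [[i /fE[Ti _] ->] // | Tj].
have [i Si Rij] := surR j Tj; exists i => //.
by have [_ /(funR _ _ _ Rij)] := fE i Si.
Qed.

Section Transversal.

Variables (gT : finGroupType) (N Y Z H : {group gT}) (S T : {set Iirr N}).
Hypotheses (nNH : H \subset 'N(N)) (defH : (Y * Z)%g = H).
Hypotheses (trT : conjg_transversal Y T S) (stT : conjg_stable Z T).

Lemma transversal_unique i y :
  i \in T -> y \in Y -> conjg_Iirr i y \in T -> conjg_Iirr i y = i.
Proof.
have [/subsetP sTS trT1] := trT => Ti Yy Ty.
have /eqP/cards1P[z zE] := trT1 i (sTS i Ti).
have iz: i \in [set z].
  by rewrite -zE inE Ti; apply/imsetP; exists 1%g; rewrite ?conjg_Iirr_inner.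
have yz: conjg_Iirr i y \in [set z].
  by rewrite -zE inE Ty; apply/imsetP; exists y.
exact: etrans (set1P yz) (esym (set1P iz)).
Qed.

Lemma transversal_conjg_eq i i' y y' :
    Y \subset 'N(N) -> i \in T -> i' \in T -> y \in Y -> y' \in Y ->
  conjg_Iirr i y = conjg_Iirr i' y' -> i = i'.
Proof.
move=> /subsetP nNY Ti Ti' Yy Yy' eqi.
have Yyy' : (y * y'^-1)%g \in Y by rewrite groupM ?groupV.
have i'E : i' = conjg_Iirr i (y * y'^-1).
  by rewrite conjg_IirrM ?nNY ?groupV // eqi conjg_IirrK.
by rewrite i'E (transversal_unique Ti Yyy') // -i'E.
Qed.

Lemma transversal_meets i : i \in S ->
  exists2 i0, i0 \in T & exists2 y, y \in Y & i = conjg_Iirr i0 y.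
Proof.
move=> Si; have [_ /(_ i Si)/eqP/cards1P[i0 i0E]] := trT.
have: i0 \in [set i0] by rewrite inE.
rewrite -i0E => /setIP[Ti0 /imsetP[y Yy Di0]]; exists i0 => //.
by exists y^-1%g; rewrite ?groupV // Di0 conjg_IirrK.
Qed.

(** If y z stabilizes i then so does z^-1 y^-1, where the z^-1-conjugate of i is
    still in T and y^-1 takes it to i; uniqueness in the transversal forces z,
    and then y, to fix i. *)
Lemma transversal_inertia i :
  i \in T -> ('I_Y['chi_i] * 'I_Z['chi_i])%g = 'I_H['chi_i].
Proof.
move=> Ti; apply/eqP; rewrite eqEsubset; apply/andP; split.
  rewrite mul_subG // setSI // -defH ?mulG_subl ?mulG_subr //.
apply/subsetP=> x /setIP[Hx Ix]; have Ixv := groupVr Ix.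
have /mulsgP[y z Yy Zz xE]: x \in (Y * Z)%g by rewrite defH.
have [Hy Hz]: y \in H /\ z \in H.
  by rewrite -defH (subsetP (mulG_subl _ _)) // (subsetP (mulG_subr _ _)).
have nN w : w \in H -> w \in 'N(N) by apply: subsetP.
have Iz: conjg_Iirr i z^-1 = i.
  have izy: conjg_Iirr (conjg_Iirr i z^-1) y^-1 = i.
    by rewrite -conjg_IirrM ?nN ?groupV // -invMg -xE conjg_Iirr_inertia.
  have Tz: conjg_Iirr i z^-1 \in T by apply: stT; rewrite ?groupV.
  have := transversal_unique Tz (groupVr Yy); by rewrite izy => <-.
have Iy: conjg_Iirr i y^-1 = i.
  by rewrite -{1}Iz -conjg_IirrM ?nN ?groupV // -invMg -xE conjg_Iirr_inertia.
have inI w : w \in H -> conjg_Iirr i w^-1 = i -> w \in 'I['chi_i].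
  move=> Hw iw; rewrite -groupV.
  by rewrite inE nN ?groupV // -conjg_IirrE iw eqxx.
by rewrite xE mem_mulg // inE ?Zz ?Yy inI.
Qed.

End Transversal.

Section TransversalOver.

Variables (gT : finGroupType) (X N Y : {group gT}) (S T : {set Iirr N}).
Hypotheses (nsNX : N <| X) (defX : (N * Y)%g = X).
Hypothesis trT : conjg_transversal Y T S.

Let sYX : Y \subset X. Proof. by rewrite -defX mulG_subr. Qed.

Lemma transversal_under (k : Iirr X) : k \in Irr_over X S ->
  exists2 i, i \in T & i \in irr_constt ('Res[N] 'chi_k).
Proof.
rewrite inE => /exists_inP[i Si ki].
have [i0 Ti0 [y Yy iE]] := transversal_meets trT Si; exists i0 => //.
have Xy := subsetP sYX y Yy.
rewrite -(irr_constt_Res_conjg i0 k (y := y)) -?iE ?conjg_Iirr_inner //.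
  exact: subsetP (normG X) y Xy.
exact: subsetP (normal_norm nsNX) y Xy.
Qed.

(** Constituents are X-conjugate by Clifford, hence Y-conjugate because N acts
    trivially on its own characters. *)
Lemma transversal_constt_unique (k : Iirr X) i i' :
    i \in T -> i' \in T -> i \in irr_constt ('Res[N] 'chi_k) ->
  i' \in irr_constt ('Res[N] 'chi_k) -> i = i'.
Proof.
move=> Ti Ti' ki ki'; have [x] := irr_constt_Res_cfclass nsNX ki ki'.
rewrite -defX => /mulsgP[g y Ng Yy ->] i'E.
have nNy := subsetP (normal_norm nsNX) y (subsetP sYX y Yy).
rewrite (conjg_IirrM i (subsetP (normG N) g Ng) nNy) in i'E.
rewrite (conjg_Iirr_inner i Ng) in i'E.
by rewrite i'E (transversal_unique trT Ti Yy) // -i'E.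
Qed.

End TransversalOver.

(** * Normalizers and Frattini's argument *)

Section SylowNormalizers.

Variables (gT : finGroupType) (l : nat) (G M Q A : {group gT}).
Hypotheses (sylQ : l.-Sylow(G) Q) (sMG : M \subset G) (nsGA : G <| A).
Hypotheses (sNQM : 'N_G(Q) \subset M) (sNQNM : 'N_A(Q) \subset 'N(M)).

Lemma normalizer_self : 'N_G(M) = M.
Proof.
apply/eqP; rewrite eqEsubset subsetI sMG normG andbT.
have sQM: Q \subset M.
  by rewrite (subset_trans _ sNQM) // subsetI normG (pHall_sub sylQ).
have sylQM: l.-Sylow(M) Q := pHall_subl sQM sMG sylQ.
have nsMN: M <| 'N_G(M) by rewrite /normal subsetI sMG normG subsetIr.
rewrite -(Frattini_arg nsMN sylQM) mul_subG //.
by rewrite (subset_trans _ sNQM) // setSI // subsetIl.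
Qed.

Lemma Frattini_normalizer (L : {group gT}) :
  G \subset L -> L \subset A -> (G * 'N_L(M))%g = L.
Proof.
move=> sGL sLA; have nsGL := normalS sGL sLA nsGA.
apply/eqP; rewrite eqEsubset mul_subG ?subsetIl //=.
rewrite -{1}(Frattini_arg nsGL sylQ) mulgS // subsetI subsetIl /=.
by rewrite (subset_trans _ sNQNM) // setSI.
Qed.

End SylowNormalizers.

Section Factorization.

Variables (gT : finGroupType) (A Gc GE G M : {group gT}).
Hypotheses (defA : (Gc * GE)%g = A) (sGGc : G \subset Gc).
Hypothesis (GNGE : (G * 'N_GE(M))%g = GE).

Lemma normalizer_mul : ('N_Gc(M) * 'N_GE(M))%g = 'N_A(M).
Proof.
apply/eqP; rewrite eqEsubset mul_subG ?setSI -?defA ?mulG_subl ?mulG_subr //=.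
apply/subsetP=> x /setIP[/mulsgP[g y Gcg GEy xE] nMx].
rewrite -GNGE in GEy; have [g' h Gg' /setIP[GEh nMh] yE] := mulsgP GEy.
have Gcgg': (g * g')%g \in Gc by rewrite groupM // (subsetP sGGc).
have nMgg': (g * g')%g \in 'N(M) by rewrite -(groupMr _ nMh) -mulgA -yE -xE.
by rewrite xE yE mulgA mem_mulg //; apply/setIP.
Qed.

End Factorization.

(** * The bijection induced on the characters of the normal subgroups *)

(** In the application Om is Omegac and D the product set Mh B; the equivariance
    of Omegac is split into that under twists and that under D. *)
Section Correspondence.

Variables (gT : finGroupType) (G M Gc Mc Mh H : {group gT}).
Hypotheses (nsGGc : G <| Gc) (abG : abelian (Gc / G)).
Hypotheses (nsMMc : M <| Mc) (abM : abelian (Mc / M)).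
Hypotheses (GMc : (G * Mc)%g = Gc) (tiGMc : G :&: Mc = M).
Hypotheses (nGH : H \subset 'N(G)) (nMH : H \subset 'N(M)).
Hypotheses (nGcH : H \subset 'N(Gc)) (nMcH : H \subset 'N(Mc)).
Hypothesis defH : (Mc * Mh)%g = H.
Variables (GG GG0 : {set Iirr G}) (MM MM0 : {set Iirr M}).
Hypotheses (stGG : conjg_stable Mc GG) (stMM : conjg_stable Mc MM).
Hypotheses (trG : conjg_transversal Mc GG0 GG) (stG : conjg_stable Mh GG0).
Hypotheses (trM : conjg_transversal Mc MM0 MM) (stM : conjg_stable Mh MM0).
Hypothesis (extG : maximal_extendibility Gc GG).
Hypothesis (extM : maximal_extendibility Mc MM).
Variable Om : Iirr Gc -> Iirr Mc.
Local Notation GGc := (Irr_over Gc GG).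
Local Notation MMc := (Irr_over Mc MM).
Hypothesis Om_bij : bij_on GGc MMc Om.
Hypothesis Om_mul : forall (mu : Iirr (Gc / G)) (la : Iirr (Mc / M)),
  matching_chars mu la ->
  {in GGc, forall k, Om (mul_mod_Iirr k mu) = mul_mod_Iirr (Om k) la}.
Variable D : gT * galQab -> Prop.
Hypothesis D_H : forall p, D p -> p.1 \in H.
Hypothesis D_Mh : {in Mh, forall h, D (h, 1%g)}.
Hypothesis D_GG0 : forall p, D p -> {in GG0, forall i, act_Iirr i p \in GG0}.
Hypothesis D_MM0 : forall p, D p -> {in MM0, forall j, act_Iirr j p \in MM0}.
Hypothesis Om_act : forall p, D p ->
  {in GGc, forall k, Om (act_Iirr k p) = act_Iirr (Om k) p}.

Definition related (i : Iirr G) (j : Iirr M) : Prop :=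
  exists2 k, i \in irr_constt ('Res[G] 'chi[Gc]_k)
           & j \in irr_constt ('Res[M] 'chi_(Om k)).

Let sGG0 : {subset GG0 <= GG}. Proof. by apply/subsetP; case: trG. Qed.
Let sMM0 : {subset MM0 <= MM}. Proof. by apply/subsetP; case: trM. Qed.

Let sMcH : Mc \subset H. Proof. by rewrite -defH mulG_subl. Qed.
Let mulMMc : (M * Mc)%g = Mc. Proof. by rewrite mulSGid ?normal_sub. Qed.
Let sMhH : Mh \subset H. Proof. by rewrite -defH mulG_subr. Qed.
Let nG x : x \in H -> x \in 'N(G). Proof. exact: subsetP. Qed.
Let nM x : x \in H -> x \in 'N(M). Proof. exact: subsetP. Qed.

Lemma related_total i : i \in GG0 -> exists2 j, j \in MM0 & related i j.
Proof.
move=> Gi; have [k] := constt_cfInd_irr i (normal_sub nsGGc).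
rewrite constt_Ind_Res => ki; have GGk := mem_Irr_over (sGG0 Gi) ki.
have: Om k \in MMc by have [_ <-] := Om_bij; apply: imset_f.
move/(transversal_under nsMMc mulMMc trM)=> [j Mj kj].
by exists j => //; exists k.
Qed.

Lemma related_onto j : j \in MM0 -> exists2 i, i \in GG0 & related i j.
Proof.
move=> Mj; have [k'] := constt_cfInd_irr j (normal_sub nsMMc).
rewrite constt_Ind_Res => kj; have := mem_Irr_over (sMM0 Mj) kj.
have [_ <-] := Om_bij => /imsetP[k GGk k'E]; rewrite k'E in kj.
have [i Gi ki] := transversal_under nsGGc GMc trG GGk.
by exists i => //; exists k.
Qed.

(** Any two witnesses of relatedness differ by a twist, which does not change
    the constituents on restriction. *)
Lemma related_fun i j j' : i \in GG -> j \in MM0 -> j' \in MM0 ->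
  related i j -> related i j' -> j = j'.
Proof.
move=> Gi Mj Mj' [k ki kj] [k2 k2i k2j'].
have [mu k2E] := abelian_quotient_transitive nsGGc abG ki k2i.
have [la mula] := matching_chars_down nsGGc GMc tiGMc mu.
rewrite k2E (Om_mul mula) ?(mem_Irr_over Gi ki) // in k2j'.
rewrite irr_constt_mul_mod // in k2j'.
exact: (transversal_constt_unique nsMMc mulMMc trM Mj Mj' kj k2j').
Qed.

Lemma Om_mul_eq k k2 (mu : Iirr (Gc / G)) (la : Iirr (Mc / M)) :
    matching_chars mu la -> k \in GGc -> k2 \in GGc ->
  Om k2 = mul_mod_Iirr (Om k) la -> k2 = mul_mod_Iirr k mu.
Proof.
move=> mula GGk GGk2; have [Oinj _] := Om_bij.
rewrite -(Om_mul mula) //; apply: Oinj => //.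
move: GGk; rewrite inE => /exists_inP[i Gi ki].
by apply: mem_Irr_over Gi _; rewrite irr_constt_mul_mod.
Qed.

Lemma related_inj i i' j : i \in GG0 -> i' \in GG0 ->
  related i j -> related i' j -> i = i'.
Proof.
move=> Gi Gi' [k ki kj] [k2 k2i' k2j].
have [la k2E] := abelian_quotient_transitive nsMMc abM kj k2j.
have [mu mula] := matching_chars_up nsGGc GMc tiGMc la.
have GGk := mem_Irr_over (sGG0 Gi) ki.
have GGk2 := mem_Irr_over (sGG0 Gi') k2i'.
rewrite (Om_mul_eq mula GGk GGk2 k2E) irr_constt_mul_mod // in k2i'.
exact: (transversal_constt_unique nsGGc GMc trG Gi Gi' ki k2i').
Qed.

Lemma related_act i j p :
  i \in GG -> D p -> related i j -> related (act_Iirr i p) (act_Iirr j p).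
Proof.
move=> Gi Dp [k ki kj]; have Hp := D_H Dp.
exists (act_Iirr k p).
  by rewrite irr_constt_Res_act ?normal_sub ?nG ?(subsetP nGcH).
rewrite (Om_act Dp) ?(mem_Irr_over Gi ki) //.
by rewrite irr_constt_Res_act ?normal_sub ?nM ?(subsetP nMcH).
Qed.

(** The stabilizers are the common kernels of the twists that fix k and Om k. *)
Lemma related_Inertia_Mc i j : i \in GG -> j \in MM ->
  related i j -> 'I_Mc['chi_i] = 'I_Mc['chi_j].
Proof.
move=> Gi Mj [k ki kj]; have [Lg /(_ i Gi) LgE] := extG.
have [Lm /(_ j Mj) LmE] := extM; have GGk := mem_Irr_over Gi ki.
have McGc x : x \in Mc -> x \in Gc.
  by rewrite -GMc; apply: subsetP (mulG_subr _ _) x.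
apply/setP=> x; rewrite ![x \in 'I__[_]]inE; apply: andb_id2l => Mcx.
apply/idP/idP=> [Ix | Ix].
  apply/negPn/negP=> I'x.
  have [|la lak la_x] := notin_Inertia_twist nsMMc abM kj Mcx.
    by rewrite inE Mcx.
  have [mu mula] := matching_chars_up nsGGc GMc tiGMc la.
  have kmu := Om_mul_eq mula GGk GGk (esym lak).
  case/eqP: la_x; rewrite -mula //.
  apply: (mul_mod_Iirr_fixed_Inertia nsGGc abG LgE ki (esym kmu)).
  by rewrite inE McGc.
apply/negPn/negP=> I'x.
have [|mu muk mu_x] := notin_Inertia_twist nsGGc abG ki (McGc x Mcx).
  by rewrite inE McGc.
have [la mula] := matching_chars_down nsGGc GMc tiGMc mu.
have lak := Om_mul mula GGk; rewrite muk in lak.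
case/eqP: mu_x; rewrite mula //.
apply: (mul_mod_Iirr_fixed_Inertia nsMMc abM LmE kj (esym lak)).
by rewrite inE Mcx.
Qed.

(** For the factor Mh of H: moving i by an element of Mh moves its partner j
    likewise, within the transversals, where partners are unique. *)
Lemma related_Inertia i j : i \in GG0 -> j \in MM0 ->
  related i j -> 'I_H['chi_i] = 'I_H['chi_j].
Proof.
move=> Gi Mj Rij.
rewrite -(transversal_inertia nGH defH trG stG Gi).
rewrite -(transversal_inertia nMH defH trM stM Mj).
rewrite (related_Inertia_Mc (sGG0 Gi) (sMM0 Mj) Rij); congr (_ * _)%g.
apply/setP=> x; rewrite !in_setI; apply: andb_id2l => Mhx.
have Hx := subsetP sMhH x Mhx; have := related_act (sGG0 Gi) (D_Mh Mhx) Rij.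
rewrite !act_Iirr_conjg !conjg_Iirr_fixed ?nG ?nM // => Rx.
have Gx := stG Mhx Gi; have Mx := stM Mhx Mj.
apply/eqP/eqP=> [ix | jx].
  rewrite ix in Rx; exact: related_fun (sGG0 Gi) Mx Mj Rx Rij.
by rewrite jx in Rx; apply: related_inj Gx Gi Rx Rij.
Qed.

Definition correspond (i : Iirr G) (j : Iirr M) : Prop :=
  exists i0 j0 m, [/\ [/\ i0 \in GG0, j0 \in MM0 & related i0 j0],
    m \in Mc, i = conjg_Iirr i0 m & j = conjg_Iirr j0 m].

Lemma correspond_total i : i \in GG -> exists2 j, j \in MM & correspond i j.
Proof.
move=> Gi; have [i0 Gi0 [m Mcm iE]] := transversal_meets trG Gi.
have [j0 Mj0 Rij] := related_total Gi0.
exists (conjg_Iirr j0 m); first exact: stMM (sMM0 Mj0).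
by exists i0, j0, m.
Qed.

Lemma correspond_onto j : j \in MM -> exists2 i, i \in GG & correspond i j.
Proof.
move=> Mj; have [j0 Mj0 [m Mcm jE]] := transversal_meets trM Mj.
have [i0 Gi0 Rij] := related_onto Mj0.
exists (conjg_Iirr i0 m); first exact: stGG (sGG0 Gi0).
by exists i0, j0, m.
Qed.

Let nGMc : Mc \subset 'N(G). Proof. exact: subset_trans nGH. Qed.
Let nMMc : Mc \subset 'N(M). Proof. exact: subset_trans nMH. Qed.

Lemma related_conjg_eq i j m m' :
    i \in GG0 -> j \in MM0 -> related i j -> m \in Mc -> m' \in Mc ->
  (conjg_Iirr i m == conjg_Iirr i m') = (conjg_Iirr j m == conjg_Iirr j m').
Proof.
move=> Gi Mj Rij Mcm Mcm'.
rewrite !conjg_Iirr_eq ?(subsetP nGMc) ?(subsetP nMMc) //.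
have := related_Inertia_Mc (sGG0 Gi) (sMM0 Mj) Rij.
by move/setP/(_ (m * m'^-1)%g); rewrite !in_setI groupM ?groupV.
Qed.

Lemma correspond_fun i j j' : correspond i j -> correspond i j' -> j = j'.
Proof.
case=> i0 [j0 [m [[Gi0 Mj0 R0] Mcm -> ->]]].
case=> i1 [j1 [m1 [[Gi1 Mj1 R1] Mcm1 eqi ->]]].
have Di1 := transversal_conjg_eq trG nGMc Gi0 Gi1 Mcm Mcm1 eqi.
rewrite -Di1 in R1 eqi; rewrite -(related_fun (sGG0 Gi0) Mj0 Mj1 R0 R1).
by apply/eqP; rewrite -(related_conjg_eq Gi0 Mj0 R0) // eqi.
Qed.

Lemma correspond_inj i i' j : correspond i j -> correspond i' j -> i = i'.
Proof.
case=> i0 [j0 [m [[Gi0 Mj0 R0] Mcm -> ->]]].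
case=> i1 [j1 [m1 [[Gi1 Mj1 R1] Mcm1 -> eqj]]].
have Dj1 := transversal_conjg_eq trM nMMc Mj0 Mj1 Mcm Mcm1 eqj.
rewrite -Dj1 in R1 eqj; rewrite -(related_inj Gi0 Gi1 R0 R1).
by apply/eqP; rewrite (related_conjg_eq Gi0 Mj0 R0) // eqj.
Qed.

Let act_conjg (N : {group gT}) (i : Iirr N) m0 m p :
    H \subset 'N(N) -> m0 \in Mc -> m \in Mc -> p.1 \in H ->
  act_Iirr (conjg_Iirr i m0) ((m, 1) * p)%g =
  conjg_Iirr (act_Iirr i p) ((m0 * m) ^ p.1).
Proof.
move=> /subsetP nNH Mcm0 Mcm Hp.
have [Hm0 Hm] := (subsetP sMcH m0 Mcm0, subsetP sMcH m Mcm).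
have Hm1: ((m0 * m) ^ p.1)%g \in H by rewrite groupJ ?groupM.
have nNmp : ((m, 1%g) * p)%g.1 \in 'N(N) by apply: nNH; apply: groupM.
rewrite -!act_Iirr_conjg -!act_IirrM ?(nNH m0) ?(nNH p.1) ?(nNH _ Hm1) //.
congr act_Iirr; rewrite mulgA.
have -> : ((m0, 1) * (m, 1) = (m0 * m, 1 : galQab))%g.
  by congr pair; apply: mul1g.
case: p {Hp Hm1 nNmp} => a t /=.
by congr pair; [exact: conjgC | rewrite [LHS]mul1g [RHS]mulg1].
Qed.

(** Acting by m and then p moves the base points i0, j0 by p, which preserves
    the transversals, and replaces the conjugator m0 by (m0 m)^p, still in
    Mc. *)
Lemma correspond_act i j m p : m \in Mc -> D p -> correspond i j ->
  correspond (act_Iirr i ((m, 1) * p)%g) (act_Iirr j ((m, 1) * p)%g).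
Proof.
move=> Mcm Dp [i0 [j0 [m0 [[Gi0 Mj0 R0] Mcm0 -> ->]]]].
have Hp := D_H Dp; pose m1 := ((m0 * m) ^ p.1)%g.
have Mcm1: m1 \in Mc by rewrite memJ_norm ?groupM // (subsetP nMcH).
exists (act_Iirr i0 p), (act_Iirr j0 p), m1; split=> //.
- by split; [apply: D_GG0 | apply: D_MM0 | apply: related_act (sGG0 Gi0) _ _].
- exact: act_conjg.
exact: act_conjg.
Qed.

Lemma correspondence_bijection : exists2 Omega : Iirr G -> Iirr M,
    bij_on GG MM Omega &
    {in GG, forall i, correspond i (Omega i) /\
       {in Mc, forall m p, D p -> Omega (act_Iirr i ((m, 1) * p)%g) =
                                  act_Iirr (Omega i) ((m, 1) * p)%g}}.
Proof.
have [Omega bijO OmegaE] := bijection_of_relation correspond_total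
  correspond_onto correspond_fun correspond_inj (ex_intro _ 0 isT).
exists Omega => // i Gi; split=> [|m Mcm p Dp]; first exact: OmegaE.
have Rp := correspond_act Mcm Dp (OmegaE i Gi).
apply: (correspond_fun (OmegaE _ _) Rp).
have [i0 [_ [m0 [[Gi0 _ _] Mcm0 -> _]]]] := Rp.
exact/stGG/sGG0.
Qed.

End Correspondence.

Theorem theorem3p4 (gT : finGroupType) (G M Q : {group gT}) (l : nat)
  (HH : {pred galQab}) (GG : {set Iirr G}) (MM : {set Iirr M})
  (* A is the semidirect product of Gc and E *)
  (Gc E A : {group gT})
  (GG0 : {set Iirr G}) (MM0 : {set Iirr M})
  (B : {pred gT * galQab}) :
  let Mc : {group gT} := 'N_Gc(M)%G in
  let GE : {group gT} := (G <*> E)%G in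
  let Mh : {group gT} := 'N_GE(M)%G in
  let GGc : {set Iirr Gc} := Irr_over Gc GG in
  let MMc : {set Iirr Mc} := Irr_over Mc MM in
  forall (Phi_glo : forall i : Iirr G, Iirr 'I_GE['chi_i])
         (Phi_loc : forall j : Iirr M, Iirr 'I_Mh['chi_j]),
  prime l -> (l %| #|G|)%N -> l.-Sylow(G) Q -> M \proper G ->
  group_closed HH ->
  (* (i) *)
  (Gc ><| E)%g = A -> G <| Gc -> abelian (Gc / G) ->
  'C_A(G) = ('Z(Gc) * 'C_E(G))%g -> G <| A ->
  act_stable (pred_prod Mc HH) GG -> act_stable (pred_prod Mc HH) MM ->
  (* (ii) *)
  'N_A(Q) \subset 'N(M) -> 'N_G(Q) \subset M ->
  (* (iii) *)
  maximal_extendibility Gc GG -> maximal_extendibility Mc MM ->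
  (* (iv) *)
  conjg_stable Mh GG0 -> conjg_transversal Mc GG0 GG ->
  conjg_stable Mh MM0 -> conjg_transversal Mc MM0 MM ->
  equivariant_extension_map Mh GG0 Phi_glo ->
  equivariant_extension_map Mh MM0 Phi_loc ->
  {in GG0 & MM0, forall i j,
     Irr_under 'C_E(G)%G 'chi_(Phi_glo i) =
     Irr_under 'C_E(G)%G 'chi_(Phi_loc j)} ->
  (* (v) *)
  group_closed B -> {subset B <= pred_prod A HH} ->
  (forall p, lprod 'N_A(Q) B p <-> p \in pred_prod 'N_A(Q) HH) ->
  act_stable B GG0 -> act_stable B MM0 ->
  (* (vi) *)
  (exists Omegac : Iirr Gc -> Iirr Mc,
     [/\ bij_on GGc MMc Omegac,
         forall (mu : Iirr (Gc / G)) (la : Iirr (Mc / M)),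
           matching_chars mu la ->
           forall p, lprod Mh B p -> {in GGc, forall i,
             Omegac (act_Iirr (mul_mod_Iirr i mu) p) =
             act_Iirr (mul_mod_Iirr (Omegac i) la) p} &
         forall nu : Iirr 'Z(Gc),
           Omegac @: (GGc :&: Irr_over Gc [set nu]) =
           MMc :&: Irr_over Mc [set nu]]) ->
  exists Omega : Iirr G -> Iirr M,
    [/\ bij_on GG MM Omega,
        {in pred_prod (Mh * Mc)%g HH, forall p, {in GG, forall i,
           Omega (act_Iirr i p) = act_Iirr (Omega i) p}} &
        {in GG, forall i, let j := Omega i in
           ge_c 'I_A['chi_i]%G i 'I_(Mc <*> Mh)['chi_j]%G j}].
Proof.

move=> Mc GE Mh GGc MMc Phi_glo Phi_loc _ _ sylQ prM HH1 sdA nsGGc abG defC.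
move=> nsGA stGG stMM sNQNM sNQM extG extM stG trG stM trM [PgE _] [PlE _].
move=> under gB _ HB B_GG0 B_MM0 [Om [Om_bij Om_eq Om_nu]].
have sMG := proper_sub prM; have sGGc := normal_sub nsGGc.
have [nsGcA sEA GcE nGcE tiGcE] := sdprod_context sdA.
have sGcA := normal_sub nsGcA; have nGA := normal_norm nsGA.
have GEE : GE = (G * E)%g :> {set gT}.
  by rewrite /= norm_joinEr // (subset_trans sEA).
have tiG : Gc :&: GE = G.
  by rewrite GEE setIC -group_modl // setIC tiGcE mulg1.
have defA : (Gc * GE)%g = A by rewrite GEE mulgA mulGSid.
have sGEA : GE \subset A by rewrite -defA mulG_subr.
have sGGE : G \subset GE by rewrite joing_subl.
have frattini := Frattini_normalizer sylQ nsGA sNQNM.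
have GMc : (G * Mc)%g = Gc := frattini _ sGGc sGcA.
have GMh : (G * Mh)%g = GE := frattini _ sGGE sGEA.
have GNA : (G * 'N_A(M))%g = A := frattini _ (normal_sub nsGA) (subxx _).
have NGM := normalizer_self sylQ sMG sNQM.
have McMh : (Mc * Mh)%g = 'N_A(M) := normalizer_mul defA sGGc GMh.
pose H := (Mc <*> Mh)%G.
have HE : H = 'N_A(M) :> {set gT}.
  apply/eqP; rewrite eqEsubset -{2}McMh mul_subG ?joing_subl ?joing_subr //.
  by rewrite join_subG !setSI.
have defH : (Mc * Mh)%g = H by rewrite HE.
have sHA : H \subset A by rewrite HE subsetIl.
have nMH : H \subset 'N(M) by rewrite HE subsetIr.
have nGH : H \subset 'N(G) := subset_trans sHA nGA.
have nGcH : H \subset 'N(Gc) := subset_trans sHA (normal_norm nsGcA).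
have nMcH : H \subset 'N(Mc) by rewrite normsI // norms_norm.
have tiGMc : G :&: Mc = M by rewrite /= setIA (setIidPl sGGc) NGM.
have tiGH : G :&: H = M by rewrite HE setIA (setIidPl (normal_sub nsGA)) NGM.
have sMMc : M \subset Mc by rewrite -tiGMc subsetIr.
have nsMMc : M <| Mc by rewrite /normal sMMc subsetIr.
have sMMh : M \subset Mh.
  by rewrite subsetI normG andbT (subset_trans sMG).
have abM : abelian (Mc / M).
  apply: sub_der1_abelian; rewrite -tiGMc subsetI der_sub andbT.
  apply: subset_trans (der1_min (normal_norm nsGGc) abG).
  by rewrite dergS // subsetIl.
have sMcH : Mc \subset H by rewrite joing_subl.
have sMhH : Mh \subset H by rewrite joing_subr.
have HH_1 : (1%g : galQab) \in HH by case: HH1.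
have stGG' : conjg_stable Mc GG.
  move=> m Mcm i Gi; rewrite -act_Iirr_conjg; apply: stGG => //.
  by rewrite inE Mcm.
have stMM' : conjg_stable Mc MM.
  move=> m Mcm i Gi; rewrite -act_Iirr_conjg; apply: stMM => //.
  by rewrite inE Mcm.
have B_norm b : b \in B -> b.1 \in H.
  move=> Bb; have: b \in pred_prod 'N_A(Q) HH.
    by apply/HB; exists 1%g, b; split=> //; rewrite mul1g.
  case/andP=> /setIP[Ab nQb] _; rewrite HE inE Ab.
  by rewrite (subsetP sNQNM) // inE Ab.
have B1 : (1%g : gT * galQab) \in B by case: gB.
pose D := lprod Mh B.
have D_H p : D p -> p.1 \in H.
  case=> a [b [Mha Bb ->]].
  by apply: groupM (B_norm b Bb); apply: subsetP sMhH a Mha.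
have D_Mh : {in Mh, forall h, D (h, 1%g)}.
  by move=> h Mhh; exists h, 1%g; split=> //; rewrite mulg1.
have D_stable (N : {group gT}) (S : {set Iirr N}) : H \subset 'N(N) ->
    conjg_stable Mh S -> act_stable B S ->
    forall p, D p -> {in S, forall i, act_Iirr i p \in S}.
  move=> /subsetP nNH stS BS _ [a [b [Mha Bb ->]]] i Si.
  have Ha := subsetP sMhH a Mha.
  rewrite (act_IirrM i (p := (a, 1%g)) (nNH a Ha) (nNH _ (B_norm b Bb))).
  rewrite act_Iirr_conjg.
  by apply: BS => //; apply: stS.
have D_GG0 := D_stable G GG0 nGH stG B_GG0.
have D_MM0 := D_stable M MM0 nMH stM B_MM0.
(* The trivial twists match, so the equivariance of Om under twists and pairs
   together splits into equivariance under each of them. *)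
have match0 : matching_chars (0 : Iirr (Gc / G)) (0 : Iirr (Mc / M)).
  move=> x Mcx; have Gcx : x \in Gc by rewrite -GMc (subsetP (mulG_subr _ _)).
  by rewrite !irr0 !cfun1E !mem_quotient.
have mul0 (X N : {group gT}) (k : Iirr X) :
    mul_mod_Iirr k (0 : Iirr (X / N)) = k.
  apply: irr_inj; rewrite /mul_mod_Iirr /mul_Iirr mod_Iirr0 irr0 mul1r.
  by rewrite irrK.
have Om_act p : D p ->
    {in GGc, forall k, Om (act_Iirr k p) = act_Iirr (Om k) p}.
  by move=> Dp k GGk; have := Om_eq _ _ match0 p Dp k GGk; rewrite !mul0.
have Om_mul (mu : Iirr (Gc / G)) (la : Iirr (Mc / M)) : matching_chars mu la ->
    {in GGc, forall k, Om (mul_mod_Iirr k mu) = mul_mod_Iirr (Om k) la}.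
  move=> mula k GGk; have := Om_eq _ _ mula _ (D_Mh _ (group1 Mh)) k GGk.
  by rewrite !act_Iirr_conjg !conjg_Iirr_inner.
(* As N_A(Q) B is all of N_A(Q) x HH, every s in HH occurs in some (y, s) in B
   with y normalizing Q and hence M; so x is y up to an element of H = Mc Mh. *)
have decomp p : p \in pred_prod (Mh * Mc)%g HH ->
    exists m q, [/\ m \in Mc, D q & p = ((m, 1) * q)%g].
  case: p => x s /andP[/= MhMcx HHs].
  have [|a [b [_ Bb]]] := (HB (1%g, s)).2; first by rewrite inE /= group1.
  case: b Bb => y t Bb [_ sE]; have Hy := B_norm _ Bb.
  have Hx : x \in H.
    have [h m Mhh Mcm ->] := mulsgP MhMcx.
    by rewrite groupM // ?(subsetP sMhH h) ?(subsetP sMcH m).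
  have /mulsgP[m h Mcm Mhh xy] : (x * y^-1)%g \in (Mc * Mh)%g.
    by rewrite defH groupM ?groupV.
  exists m, ((h, 1) * (y, t))%g; split=> //; first by exists h, (y, t).
  rewrite mulgA -[RHS]/((m * h * y)%g, (1 * 1 * t)%g) -xy mulgKV.
  by rewrite mul1g sE.
have [Omega bijO OmegaE] := correspondence_bijection nsGGc abG nsMMc abM GMc
  tiGMc nGH nMH nGcH nMcH defH stGG' stMM' trG trM extG extM Om_bij Om_mul D_H
  D_GG0 D_MM0 Om_act.
exists Omega; split=> // [p /decomp[m [q [Mcm Dq ->]]] i Gi | i Gi].
  by have [_ ->] := OmegaE i Gi.
have [[i0 [j0 [m [[Gi0 Mj0 Rij] Mcm iE jE]]]] _] := OmegaE i Gi.
have Hm := subsetP sMcH m Mcm; have Am := subsetP sHA m Hm.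
have nGm := subsetP nGH m Hm; have nMm := subsetP nMH m Hm.
(* It suffices to treat the base points of the transversals. *)
rewrite /= jE iE.
suff base: ge_c 'I_A['chi_i0]%G i0 'I_H['chi_j0]%G j0.
  have conjI (L N : {group gT}) (r : Iirr N) : m \in L -> m \in 'N(N) ->
      ('I_L['chi_r] :^ m)%G = 'I_L['chi_(conjg_Iirr r m)]%G.
    move=> Lm nNm; apply: val_inj.
    by rewrite /= conjIg conjGid // conjg_inertia // conjg_IirrE.
  by have := ge_cJ nGm nMm base; rewrite !conjI.
have Iij := related_Inertia nsGGc abG nsMMc abM GMc tiGMc nGH nMH nGcH nMcH defH
  trG stG trM stM extG extM Om_bij Om_mul D_H D_Mh Om_act Gi0 Mj0 Rij.
have defHi := transversal_inertia nGH defH trG stG Gi0.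
have defHj := transversal_inertia nMH defH trM stM Mj0.
have [sGG0 sMM0] : GG0 \subset GG /\ MM0 \subset MM.
  by case: trG => + _; case: trM => + _.
have GGi0 := subsetP sGG0 i0 Gi0.
have [k ki kj] := Rij.
have GGk := mem_Irr_over GGi0 ki.
have [[Lg LgE] [Lm LmE]] := (extG, extM).
have [nu nuk] := constt_cfRes_irr 'Z(Gc) k.
have nuk' : nu \in irr_constt ('Res['Z(Gc)] 'chi_(Om k)).
  have: Om k \in MMc :&: Irr_over Mc [set nu].
    rewrite -Om_nu; apply: imset_f; rewrite inE GGk inE.
    by apply/exists_inP; exists nu; rewrite ?set11.
  by case/setIP=> _; rewrite inE => /exists_inP[nu' /set1P->].
have sCM : 'C_A(G) \subset 'C(M).
  by rewrite subIset // (centS sMG) orbT.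
have sZMc : 'Z(Gc) \subset Mc.
  rewrite subsetI subsetIl cents_norm //.
  by rewrite (subset_trans _ sCM) // defC mulG_subl.
have sCMh : 'C_E(G) \subset Mh.
  rewrite subsetI subIset ?joing_subr //= cents_norm //.
  by rewrite (subset_trans _ sCM) // defC mulG_subr.
have defAi : ('I_Gc['chi_i0] * 'I_GE['chi_i0])%g = 'I_A['chi_i0].
  apply/eqP; rewrite eqEsubset mul_subG ?setSI //=.
  have -> : 'I_A['chi_i0] = (G * 'I_H['chi_i0])%g.
    by rewrite group_modl ?sub_inertia // HE GNA.
  rewrite -defHi mulgA mulgSS ?setSI ?subsetIl //.
  by rewrite mul_subG ?sub_Inertia ?setSI // subsetIl.
have GH : (G * H)%g = A by rewrite HE.
have sMhGE : Mh \subset GE by apply: subsetIl.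
have twist y (mu : Iirr (Gc / G)) (la : Iirr (Mc / M)) :
    y \in Mh -> matching_chars mu la -> k = mul_mod_Iirr (conjg_Iirr k y) mu ->
  Om k = mul_mod_Iirr (conjg_Iirr (Om k) y) la.
  move=> Mhy mula kE; rewrite {1}kE (Om_mul _ _ mula).
    by rewrite -(act_Iirr_conjg k y) Om_act ?act_Iirr_conjg //; apply: D_Mh.
  have Hy := subsetP sMhH y Mhy.
  apply: mem_Irr_over (subsetP sGG0 _ (stG y Mhy i0 Gi0)) _.
  by rewrite irr_constt_Res_conjg ?(subsetP nGcH) ?(subsetP nGH).
exact: (ge_c_correspondents nsGA nsGcA sGEA nsGGc abG sGGE tiG sHA GH tiGH nMcH
  sMcH sMhH GMc sMhGE nsMMc abM sMMh (Z := 'Z(Gc)%G) (C := 'C_E(G)%G) defC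
  (subxx _) sZMc sCMh Iij defAi defHj ki kj (LgE i0 GGi0)
  (LmE j0 (subsetP sMM0 j0 Mj0)) (PgE i0 Gi0) (PlE j0 Mj0) twist nuk nuk'
  (under _ _ Gi0 Mj0)).
Qed.
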